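(* Let $T$ be a complete first-order theory which is NTP$_{2}$, and let $M\models T$. Then for every Keisler measure $\mu$ over $M$ in the variable $x$, there exist an elementary extension $N\succ M$ (inside the monster model) and a Keisler measure $\mu'$ over $N$ in the variable $x$ extending $\mu$ such that $\mu'$ is NTP$_{2}$-smooth.
   Context: $\mathfrak{C}$ denotes the monster model of $T$. A Keisler measure over a set $A$ in the variable $x$ is a finitely additive probability measure on the Boolean algebra $L_{x}(A)$ of formulas (definable sets) in $x$ with parameters from $A$. A formula $\varphi(x,y)$ has TP$_{2}$ if there are an array $\langle a_{i,j} : i,j<\omega\rangle$ and $k<\omega$ such that for every $\eta:\omega\to\omega$ the set $\{\varphi(x,a_{i,\eta(i)}) : i<\omega\}$ is consistent and each row $\{\varphi(x,a_{i,j}) : j<\omega\}$ is $k$-inconsistent; $T$ is NTP$_{2}$ if no formula has TP$_{2}$. A formula $\varphi(x,b)$ divides over $A$ if there is an $A$-indiscernible sequence $\langle b_i:i<\omega\rangle$ with $b_0=b$ such that $\{\varphi(x,b_i):i<\omega\}$ is inconsistent. A Keisler measure $\mu$ over $A$ in $x$ is NTP$_{2}$-smooth if for every set $B\supseteq A$ and every Keisler measure $\mu''$ over $B$ in $x$ extending $\mu$, every formula $\varphi(x,b)\in L_x(B)$ which divides over $A$ satisfies $\mu''(\varphi(x,b))=0$. *)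

(* Defs.v *)
From mathcomp Require Import all_boot all_order all_algebra.
From mathcomp Require Import all_classical all_reals.

Set Implicit Arguments.
Unset Strict Implicit.
Unset Printing Implicit Defensive.

Local Open Scope classical_set_scope.
Local Open Scope ring_scope.

Record language := Language {
  fsym : Type;
  farity : fsym -> nat;
  rsym : Type;
  rarity : rsym -> nat }.

Inductive term (L : language) (V : Type) : Type :=
| tvar of V
| tapp (f : fsym L) of ('I_(farity f) -> term L V).

(* [formula L V]: first-order L-formulas with equality whose free variables
   are among the elements of [V]; a quantifier binds [None]. A partitioned
   formula phi(x, y) with |x| = n, |y| = m is a [formula L ('I_n + 'I_m)]. *)
Inductive formula (L : language) (V : Type) : Type :=
| fbot
| feq of term L V & term L V
| fatom (r : rsym L) of ('I_(rarity r) -> term L V)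
| fimp of formula L V & formula L V
| fall of formula L (option V).

Arguments tvar {L V}.
Arguments tapp {L V}.
Arguments fbot {L V}.
Arguments feq {L V}.
Arguments fatom {L V}.
Arguments fimp {L V}.
Arguments fall {L V}.

Definition fnot L V (phi : formula L V) : formula L V := fimp phi fbot.

Definition sentence (L : language) := formula L void.

Record structure (L : language) := Structure {
  dom :> Type;
  dom_inhabited : inhabited dom;
  fint : forall f : fsym L, ('I_(farity f) -> dom) -> dom;
  rint : forall r : rsym L, ('I_(rarity r) -> dom) -> Prop }.

Arguments fint {L} s f.
Arguments rint {L} s r.

Fixpoint eval L (C : structure L) V (v : V -> C) (t : term L V) : C :=
  match t with
  | tvar x => v x
  | tapp f ts => fint C f (fun i => eval v (ts i))
  end.

Fixpoint sat L (C : structure L) V (v : V -> C) (phi : formula L V) : Prop :=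
  match phi with
  | fbot => False
  | feq s t => eval v s = eval v t
  | fatom r ts => rint C r (fun i => eval v (ts i))
  | fimp p q => sat v p -> sat v q
  | fall p => forall c : C, sat (oapp v c) p
  end.

Definition holds L (C : structure L) (phi : sentence L) : Prop :=
  sat (of_void C) phi.

Definition theory (L : language) := set (sentence L).

Definition models L (C : structure L) (T : theory L) : Prop :=
  forall phi, T phi -> holds C phi.

Definition entails L (T : theory L) (phi : sentence L) : Prop :=
  forall C : structure L, models C T -> holds C phi.

Definition complete_theory L (T : theory L) : Prop :=
  (exists C : structure L, models C T) /\
  forall phi, entails T phi \/ entails T (fnot phi).

Section Substructures.
Variables (L : language) (C : structure L).

Definition fclosed (A : set C) : Prop :=
  forall (f : fsym L) (a : 'I_(farity f) -> C),
    (forall i, A (a i)) -> A (fint C f a).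

Lemma sub_inhabited (A : set C) : A !=set0 -> inhabited {c : C | A c}.
Proof. by case=> c Ac; exact: (inhabits (exist _ c Ac)). Qed.

Definition substructure (A : set C) (A0 : A !=set0) (Af : fclosed A) :
    structure L :=
  {| dom := {c : C | A c};
     dom_inhabited := sub_inhabited A0;
     fint := fun f a => exist A (fint C f (fun i => sval (a i)))
                          (Af f (fun i => sval (a i)) (fun i => svalP (a i)));
     rint := fun r a => rint C r (fun i => sval (a i)) |}.

Definition elementary_substructure (A : set C) : Prop :=
  exists (A0 : A !=set0) (Af : fclosed A),
    forall (m : nat) (phi : formula L 'I_m) (a : 'I_m -> substructure A0 Af),
      sat a phi <-> sat (fun i => sval (a i) : C) phi.

End Substructures.

Section Definable.
Variables (L : language) (C : structure L).

Definition valpair n m (a : 'I_n -> C) (b : 'I_m -> C) (x : 'I_n + 'I_m) : C :=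
  match x with inl i => a i | inr j => b j end.

(* The set phi(C, b) defined by phi(x, b). *)
Definition defset n m (phi : formula L ('I_n + 'I_m)) (b : 'I_m -> C) :
    set ('I_n -> C) :=
  [set a | sat (valpair a b) phi].

(* The elements of L_x(A), |x| = n: formulas over A are identified with the
   sets that they define in the monster model. *)
Definition definable n (A : set C) (D : set ('I_n -> C)) : Prop :=
  exists (m : nat) (phi : formula L ('I_n + 'I_m)) (b : 'I_m -> C),
    (forall j, A (b j)) /\ D = defset phi b.

(* Consistency with the elementary diagram of C: by compactness, this is
   finite satisfiability in C. *)
Definition consistent n (p : set (set ('I_n -> C))) : Prop :=
  forall F : set (set ('I_n -> C)), finite_set F -> F `<=` p ->
    \bigcap_(D in F) D !=set0.

Definition automorphism (s : C -> C) : Prop :=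
  [/\ bijective s,
      forall (f : fsym L) a, s (fint C f a) = fint C f (fun i => s (a i)) &
      forall (r : rsym L) a, rint C r a <-> rint C r (fun i => s (a i))].

(* [h] restricted to [A] is a partial elementary map. *)
Definition elementary_on (A : set C) (h : C -> C) : Prop :=
  forall (m : nat) (phi : formula L 'I_m) (a : 'I_m -> C),
    (forall i, A (a i)) -> sat a phi <-> sat (fun i => h (a i)) phi.

End Definable.

(* A type [K] stands for its cardinal kappa = |K|. *)
Definition card_lt T U (A : set T) (B : set U) : Prop := ~ (B #<= A)%card.

Definition small L (K : Type) (C : structure L) (A : set C) : Prop :=
  card_lt A [set: K].

Definition saturated L (K : Type) (C : structure L) : Prop :=
  forall A : set C, small K A ->
  forall (n : nat) (p : set (set ('I_n -> C))),
    p `<=` definable A -> consistent p -> \bigcap_(D in p) D !=set0.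

Definition strongly_homogeneous L (K : Type) (C : structure L) : Prop :=
  forall A : set C, small K A ->
  forall h : C -> C, elementary_on A h ->
    exists2 s : C -> C, automorphism s & {in A, s =1 h}.

(* C is a kappa-saturated, strongly kappa-homogeneous model of T, for a
   cardinal kappa > |L| + aleph_0. *)
Definition monster_model L (K : Type) (T : theory L) (C : structure L) : Prop :=
  [/\ card_lt [set: nat] [set: K],
      card_lt [set: fsym L] [set: K] /\ card_lt [set: rsym L] [set: K],
      models C T,
      saturated K C &
      strongly_homogeneous K C].

Section Dividing.
Variables (L : language) (C : structure L).

(* k-inconsistency refers to k distinct indices, not k distinct formulas. *)
Definition k_inconsistent n (k : nat) (D : nat -> set ('I_n -> C)) : Prop :=
  forall s : seq nat, uniq s -> size s = k ->
    ~ exists a, forall j, j \in s -> D j a.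

Definition TP2 n m (phi : formula L ('I_n + 'I_m)) : Prop :=
  exists (a : nat -> nat -> 'I_m -> C) (k : nat),
    (forall eta : nat -> nat,
       consistent (range (fun i => defset phi (a i (eta i))))) /\
    (forall i, k_inconsistent k (fun j => defset phi (a i j))).

Definition NTP2 : Prop :=
  forall (n m : nat) (phi : formula L ('I_n + 'I_m)), ~ TP2 phi.

Definition seqval m k p (b : nat -> 'I_m -> C) (i : 'I_k -> nat)
    (c : 'I_p -> C) (x : 'I_k * 'I_m + 'I_p) : C :=
  match x with inl (r, s) => b (i r) s | inr q => c q end.

Definition indiscernible m (A : set C) (b : nat -> 'I_m -> C) : Prop :=
  forall (k p : nat) (psi : formula L ('I_k * 'I_m + 'I_p)) (c : 'I_p -> C)
    (i j : 'I_k -> nat),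
    (forall q, A (c q)) ->
    {homo i : r s / (r < s)%N} -> {homo j : r s / (r < s)%N} ->
    sat (seqval b i c) psi <-> sat (seqval b j c) psi.

Definition divides n m (A : set C) (phi : formula L ('I_n + 'I_m))
    (b : 'I_m -> C) : Prop :=
  exists bs : nat -> 'I_m -> C,
    [/\ indiscernible A bs, bs 0%N = b &
        ~ consistent (range (fun i => defset phi (bs i)))].

End Dividing.

Arguments NTP2 {L} C.

Section KeislerMeasures.
Variables (R : realType) (L : language) (C : structure L) (n : nat).

(* Only the values of [mu] on A-definable sets matter. *)
Definition keisler_measure (A : set C) (mu : set ('I_n -> C) -> R) : Prop :=
  [/\ forall D, definable A D -> 0 <= mu D,
      mu setT = 1 &
      forall D E, definable A D -> definable A E -> D `&` E = set0 ->
        mu (D `|` E) = mu D + mu E].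

(* [nu] extends the measure [mu] over [A]. *)
Definition extends (A : set C) (mu nu : set ('I_n -> C) -> R) : Prop :=
  forall D, definable A D -> nu D = mu D.

Definition NTP2_smooth (A : set C) (mu : set ('I_n -> C) -> R) : Prop :=
  forall (B : set C) (nu : set ('I_n -> C) -> R),
    A `<=` B -> keisler_measure B nu -> extends A mu nu ->
    forall (m : nat) (phi : formula L ('I_n + 'I_m)) (b : 'I_m -> C),
      (forall j, B (b j)) -> divides A phi b -> nu (defset phi b) = 0.

End KeislerMeasures.

(* Main.v *)
(**
Keisler measures are extended to finitely additive probabilities on all subsets
of C^n. Fix phi, k and eps, and suppose that no extension of mu by finitely many
parameters prevents its further extensions from giving measure at least eps to
instances of phi that k-divide over the parameters. Starting with such an
instance phi(x, b), where b = b_0 and (b_j) witnesses dividing over A_i,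
averaging the extension over automorphisms fixing A_i and carrying b_0 to b_j,
j < w, gives mu_(i+1) with

   mu_(i+1)(D & phi(x, b_j)) >= la_i(D) / w   for D definable over A_i,

where la_i(D) is the former measure of D & phi(x, b_0). Let mu and la be
ultralimits of mu_i and la_i, and choose a definable D0 that nearly maximizes
la - (eps / 2) mu: on definable subsets G of D0, la is at least (eps / 2) mu up
to a small error, and so la(G & phi(x, b^i_j)) is at least about
(eps / 2w) la_i(G), which is close to (eps / 2w) la(G) for suitable large i.
Hence rows i can be selected one after the other so that all paths through the
array (b^i_j) of width w are consistent, and by compactness phi has TP2.

So each triple (phi, k, eps) can be dealt with by adding finitely many
parameters, and this is preserved by further extensions. Zorn's lemma treats all
triples, with at most |M| + |L| + aleph_0 parameters, and a Skolem hull of these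
is the required model N.
*)

Require Import Defs.
From mathcomp Require Import all_boot all_order all_algebra.
From mathcomp Require Import all_classical all_reals.
From mathcomp Require Import lra.

Set Implicit Arguments.
Unset Strict Implicit.
Unset Printing Implicit Defensive.

Local Open Scope classical_set_scope.
Local Open Scope ring_scope.

Import Order.TTheory GRing.Theory Num.Theory.

(** * Cardinals as embeddability of types *)

Definition embeds (X Y : Type) := exists f : X -> Y, injective f.

Lemma sval_inj T (P : T -> Prop) : injective (fun u : {x | P x} => sval u).
Proof. by move=> [u Pu] [v Pv] /= e; exact: eq_exist. Qed.

Lemma embeds_trans X Y Z : embeds X Y -> embeds Y Z -> embeds X Z.
Proof. by case=> f fi [g gi]; exists (g \o f); exact: inj_comp. Qed.

(** Zorn's lemma on graphs of partial injections: a maximal graph is total on one side, since a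
    point missing on each side would give a pair to add. *)
Lemma embeds_total X Y : embeds X Y \/ embeds Y X.
Proof.
pose P (G : set (X * Y)) := forall p q, G p -> G q -> p.1 = q.1 <-> p.2 = q.2.
have [F FP tF|G [PG maxG]] := @Zorn_bigcup _ P.
  move=> p q [A FA Ap] [B FB Bq].
  by have [sAB|sBA] := tF _ _ FA FB;
    [apply: (FP _ FB) => //; exact: sAB|apply: (FP _ FA) => //; exact: sBA].
have [dG|/existsNP[x Nx]] := pselect (forall x, exists y, G (x, y)).
  left; have [f fG] := choice dG; exists f => x x' fxx'.
  by have [_ /(_ fxx')] := PG _ _ (fG x) (fG x').
have [rG|/existsNP[y Ny]] := pselect (forall y, exists x, G (x, y)).
  right; have [f fG] := choice rG; exists f => y y' fyy'.
  by have [/(_ fyy')] := PG _ _ (fG y) (fG y').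
exfalso; apply: (maxG (G `|` [set (x, y)])).
  split; first by move=> p Gp; left.
  by move=> /(_ (x, y)) H; apply: Nx; exists y; apply: H; right.
move=> [x1 y1] [x2 y2] [G1|[-> ->]] [G2|[-> ->]] //=.
- exact: (PG _ _ G1 G2).
- by split=> [e|e]; exfalso; [apply: Nx; exists y1|apply: Ny; exists x1];
    rewrite -e.
- by split=> [e|e]; exfalso; [apply: Nx; exists y2|apply: Ny; exists x2];
    rewrite e.
Qed.

(** * Squares of infinite cardinals *)

Section Square.
Variable Y : Type.

(** The underlying set is read off the diagonal, so the graph alone determines it. *)
Definition square_field (G : set (Y * Y * Y)) : set Y :=
  [set y | exists w, G ((y, y), w)].

(** Together the three clauses make [G] the graph of an injection from the square of its field into
    the field. *)
Definition square_graph (G : set (Y * Y * Y)) : Prop :=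
  [/\ forall p q, G p -> G q -> p.1 = q.1 <-> p.2 = q.2,
      forall p, G p -> [/\ square_field G p.1.1, square_field G p.1.2 &
                          square_field G p.2] &
      forall x y, square_field G x -> square_field G y ->
        exists w, G ((x, y), w)].

Lemma square_graph_bigcup (F : set (set (Y * Y * Y))) :
  F `<=` square_graph -> total_on F subset -> square_graph (\bigcup_(G in F) G).
Proof.
move=> FP tF; have sub G y : F G -> square_field G y ->
    square_field (\bigcup_(G in F) G) y.
  by move=> FG [w Gw]; exists w; exists G.
split.
- move=> p q [A FA Ap] [B FB Bq]; have [sAB|sBA] := tF _ _ FA FB.
  + by have [H _ _] := FP _ FB; apply: H => //; exact: sAB.
  + by have [H _ _] := FP _ FA; apply: H => //; exact: sBA.
- move=> p [A FA Ap]; have [_ H _] := FP _ FA.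
  by have [H1 H2 H3] := H _ Ap; split; exact: (sub A).
- move=> x y [w [A FA Aw]] [v [B FB Bv]]; have [sAB|sBA] := tF _ _ FA FB.
  + have [_ _ H] := FP _ FB; have [||u Bu] := H x y; [by exists w; exact: sAB|by exists v|].
    by exists u; exists B.
  + have [_ _ H] := FP _ FA; have [||u Au] := H x y; [by exists w|by exists v; exact: sBA|].
    by exists u; exists A.
Qed.

Lemma square_graph_nat (e : nat -> Y) : injective e ->
  square_graph [set ((e i, e j), e (pickle (i, j))) | i in setT & j in setT].
Proof.
move=> ei; set G := (X in square_graph X).
have fe i : square_field G (e i) by exists (e (pickle (i, i))); exists i => //; exists i.
split.
- move=> _ _ [i _ [j _ <-]] [i' _ [j' _ <-]] /=; split=> [[/ei -> /ei ->]//|].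
  by move=> /ei/(pcan_inj pickleK)[-> ->].
- by move=> _ [i _ [j _ <-]]; split; exact: fe.
- move=> x y [w [i _ [i' _ [<- _ _]]]] [v [j _ [j' _ [<- _ _]]]].
  by exists (e (pickle (i, j))), i => //; exists j.
Qed.

(** With [A] the field and [h] a copy of it outside, the pairs with some coordinate in the copy are
    sent injectively into the copy. They form three copies of the square of [A], which [f] packs
    into [A]. *)
Lemma square_graph_ext (G : set (Y * Y * Y)) (e : nat -> Y)
    (h : {y | square_field G y} -> {y | ~ square_field G y}) :
  square_graph G -> injective e -> (forall i, square_field G (e i)) ->
  injective h -> exists2 H, square_graph H & G `<` H.
Proof.
move=> [G1 G2 G3] ei Ge hi; set A := square_field G in h hi G2 G3 Ge *.
have [f fP] : exists f : {y | A y} -> {y | A y} -> {y | A y},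
    forall x y, G ((sval x, sval y), sval (f x y)).
  have H (p : {y | A y} * {y | A y}) : exists w : {y | A y},
      G ((sval p.1, sval p.2), sval w).
    case: p => [[x Ax] [y Ay]] /=; have [w Gw] := G3 _ _ Ax Ay.
    by have [_ _ Aw] := G2 _ Gw; exists (exist _ w Aw).
  by have [f fP] := choice H; exists (fun x y => f (x, y)) => x y; exact: fP (x, y).
have fi x y x' y' : f x y = f x' y' -> x = x' /\ y = y'.
  move=> e1; have [_ /=] := G1 _ _ (fP x y) (fP x' y').
  by rewrite e1 => /(_ erefl)[/sval_inj -> /sval_inj ->].
pose inA b (u : {y | A y}) : Y := if b : bool then sval (h u) else sval u.
have inAi b c u v : inA b u = inA c v -> b = c /\ u = v.
  case: b c => -[] /=; rewrite /inA.
  - by move=> /sval_inj/hi ->.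
  - by move=> e1; exfalso; apply: (svalP (h u)); rewrite e1; exact: (svalP v).
  - by move=> e1; exfalso; apply: (svalP (h v)); rewrite -e1; exact: (svalP u).
  - by move/sval_inj ->.
pose a i : {y | A y} := exist _ (e i) (Ge i).
have ai i j : a i = a j -> i = j by move=> [/ei].
(* The two bits record which coordinates lie in the copy. *)
pose code (b c : bool) u v := f (a (pickle (b, c))) (f u v).
have codei b c u v b' c' u' v' : code b c u v = code b' c' u' v' ->
    [/\ b = b', c = c', u = u' & v = v'].
  by move=> /fi[/ai/(pcan_inj pickleK)[-> ->] /fi[-> ->]].
pose H := G `|` [set p | exists b c u v, is_true (b || c) /\
  p = ((inA b u, inA c v), sval (h (code b c u v)))].
have HA (u : {y | A y}) : square_field H (sval u).
  by exists (sval (f u u)); left; exact: fP.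
have HhA u : square_field H (sval (h u)).
  by exists (sval (h (code true true u u))); right; exists true, true, u, u.
have Hin b u : square_field H (inA b u) by case: b; [exact: HhA|exact: HA].
have GA p : G p -> exists u v : {y | A y}, p = ((sval u, sval v), sval (f u v)).
  case: p => [[x y] w] Gp; have [/= Ax Ay Aw] := G2 _ Gp.
  exists (exist _ x Ax), (exist _ y Ay) => /=; congr (_, _).
  by have [/(_ erefl)] := G1 _ _ Gp (fP (exist _ x Ax) (exist _ y Ay)).
have Hfld x : square_field H x -> exists b (u : {y | A y}), x = inA b u.
  move=> [w [/GA[u [v [-> _ _]]]|[b [c [u [v [_ [-> _ _]]]]]]]].
    by exists false, u.
  by exists b, u.
exists H; last first.
  split; first by move=> p Gp; left.
  move=> HG; have /HG/G2[/= H1 _ _] : H ((inA true (a 0%N), inA true (a 0%N)),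
      sval (h (code true true (a 0%N) (a 0%N)))).
    by right; exists true, true, (a 0%N), (a 0%N).
  exact: (svalP (h (a 0%N))).
split.
- move=> p q [Gp|[b [c [u [v [bc ->]]]]]] [Gq|[b' [c' [u' [v' [bc' ->]]]]]].
  + exact: G1.
  + have [u [v ->]] := GA _ Gp; split => /=.
      move=> [/(inAi false)[e1 _] /(inAi false)[e2 _]].
      by move: bc'; rewrite -e1 -e2.
    by move=> /(inAi false true)[].
  + have [u' [v' ->]] := GA _ Gq; split => /=.
      move=> [/(inAi b false)[e1 _] /(inAi c false)[e2 _]].
      by move: bc; rewrite e1 e2.
    by move=> /(inAi true false)[].
  + split=> /= [[/inAi[-> ->] /inAi[-> ->]]//|].
    by move=> /sval_inj/hi/codei[-> -> -> ->].
- move=> p [/GA[u [v ->]]|[b [c [u [v [bc ->]]]]]] /=; first by split.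
  by split.
- move=> x y /Hfld[b [u ->]] /Hfld[c [v ->]].
  have [bc|] := boolP (b || c).
    by exists (sval (h (code b c u v))); right; exists b, c, u, v.
  by case: b c => -[]// _; exists (sval (f u v)); left; exact: fP.
Qed.

(** By [square_graph_ext], the field [A] of a maximal graph does not embed in its complement. So the
    complement embeds in [A], hence [Y] embeds in [A], and the injection given by the graph
    transfers to [Y]. *)
Lemma embeds_square : embeds nat Y -> embeds (Y * Y) Y.
Proof.
move=> [e ei].
set G0 := [set ((e i, e j), e (pickle (i, j))) | i in setT & j in setT].
have PG0 : square_graph G0 := square_graph_nat ei.
(* Joining [G0] to every graph keeps the field infinite and also settles the empty chain. *)
have [F FP tF|G1 [PG1 maxG1]] := @Zorn_bigcup _ (fun G => square_graph (G `|` G0)).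
  pose F' := [set G | G = G0 \/ exists2 X, F X & G = X `|` G0].
  suff -> : \bigcup_(X in F) X `|` G0 = \bigcup_(G in F') G.
    apply: square_graph_bigcup => [G [->//|[X FX ->]]|]; first exact: FP.
    move=> _ _ [->|[X FX ->]] [->|[X' FX' ->]]; try by [left; move=> x; right|left].
      by right=> x; right.
    by have [s|s] := tF _ _ FX FX'; [left|right] => x [/s|]; [left|right|left|right].
  apply/seteqP; split=> x.
    move=> [[X FX Xx]|G0x]; last by exists G0 => //; left.
    by exists (X `|` G0); [right; exists X|left].
  move=> [G [->|[X FX ->]]]; first by right.
  by case=> [Xx|]; [left; exists X|right].
set G := G1 `|` G0 in PG1; have Ge i : square_field G (e i).
  by exists (e (pickle (i, i))); right; exists i => //; exists i.
pose A := square_field G.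
have [[h hi]|[h hi]] := embeds_total {y | A y} {y | ~ A y}.
  have [H PH GH] := square_graph_ext PG1 ei Ge hi; exfalso.
  apply: (maxG1 H).
    split=> [x G1x|HG]; first by apply: (properW GH); left.
    by apply: (proj2 GH) => x /HG; left.
  rewrite setUidl // => x G0x; by apply: (properW GH); right.
have [K1 K2 K3] := PG1.
have H (p : {y | A y} * {y | A y}) : exists w : {y | A y},
    G ((sval p.1, sval p.2), sval w).
  case: p => [[x Ax] [y Ay]] /=; have [w Gw] := K3 _ _ Ax Ay.
  by have [_ _ Aw] := K2 _ Gw; exists (exist _ w Aw).
have [f fP] := choice H.
have fi : injective f.
  move=> [x y] [x' y'] e1; have [_ /=] := K1 _ _ (fP (x, y)) (fP (x', y')).
  by rewrite e1 => /(_ erefl)[/sval_inj -> /sval_inj ->].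
pose a i : {y | A y} := exist _ (e i) (Ge i).
(* [a 0] and [a 1] tell the points of [A] from the others. *)
pose g y : {y | A y} := match pselect (A y) with
  | left Ay => f (a 0%N, exist _ y Ay)
  | right NAy => f (a 1%N, h (exist _ y NAy)) end.
have gi : injective g.
  move=> x y; rewrite /g; case: pselect => Ax; case: pselect => Ay.
  - by move=> /fi[].
  - by move=> /fi[/ei].
  - by move=> /fi[/ei].
  - by move=> /fi[/hi[]].
exists (fun p => sval (f (g p.1, g p.2))) => -[x y] [x' y'] /= /sval_inj/fi[].
by move=> /gi -> /gi ->.
Qed.

End Square.

(** The length is stored too, because iterated pairing is guaranteed to separate lists only when
    their lengths agree. *)
Lemma embeds_seq Y : embeds nat Y -> embeds (seq Y) Y.
Proof.
move=> eY; have [f fi] := embeds_square eY; have [e ei] := eY.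
pose g := foldr (fun y z => f (y, z)) (e 0%N).
have gi s t : size s = size t -> g s = g t -> s = t.
  by elim: s t => [|y s IH] [|z t] //= [/IH{}IH] /fi[-> /IH ->].
exists (fun s => f (e (size s), g s)) => s t /fi[/ei]; exact: gi.
Qed.

Lemma embeds_add X X' Y : embeds nat Y -> embeds X Y -> embeds X' Y ->
  embeds (X + X') Y.
Proof.
move=> eY [g gi] [g' gi']; have [f fi] := embeds_square eY; have [e ei] := eY.
exists (fun c => match c with inl x => f (e 0%N, g x) | inr x => f (e 1%N, g' x) end).
by move=> [x|x] [y|y] /fi => [[/gi ->]|[/ei]|[/ei]|[/gi' ->]].
Qed.

Lemma embeds_sigT (P : nat -> Type) Y : embeds nat Y ->
  (forall m, embeds (P m) Y) -> embeds {m & P m} Y.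
Proof.
move=> eY PY; have [f fi] := embeds_square eY; have [e ei] := eY.
exists (fun u => let: existT m p := u in f (e m, sval (cid (PY m)) p)).
move=> [m p] [m' p'] /fi[/ei em]; case: _ / em p' => p'.
by case: cid => /= g gi /gi ->.
Qed.

Lemma embeds_tree X Y : embeds nat Y -> embeds X Y -> embeds (GenTree.tree X) Y.
Proof.
move=> eY eX; have [f fi] := embeds_add eY eY eX.
apply: (@embeds_trans _ (seq (nat + X))).
  by exists (@GenTree.encode X); exact: pcan_inj (GenTree.codeK X).
apply: (@embeds_trans _ (seq Y)); last exact: embeds_seq.
by exists (map f); exact: inj_map.
Qed.

(* A row of [K * K] sent entirely into [X] embeds [K] in [X]; otherwise every
   row has a point sent to [Y], and these points embed [K] in [Y]. *)
Lemma embeds_sum (K X Y : Type) : embeds nat K -> embeds K (X + Y) ->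
  embeds K X \/ embeds K Y.
Proof.
move=> /embeds_square[s si] [f fi].
have [[k Hk]|NK] := pselect (exists k, forall l, exists x, f (s (k, l)) = inl x).
  left; have [g gP] := choice Hk; exists g => l l' e.
  by have /fi/si[] : f (s (k, l)) = f (s (k, l')) by rewrite !gP e.
right; have H k : exists y, exists l, f (s (k, l)) = inr y.
  apply: contrapT => N; apply: NK; exists k => l.
  case E : (f _) => [x|y]; first by exists x.
  by exfalso; apply: N; exists y, l.
have [g gP] := choice H; exists g => k k' e.
have [l El] := gP k; have [l' El'] := gP k'.
by have /fi/si[] : f (s (k, l)) = f (s (k', l')) by rewrite El El' e.
Qed.

Lemma card_leTE (K U : Type) (A : set U) :
  ([set: K] #<= A)%card <-> embeds K {x | A x}.
Proof.
split=> [/card_leP[f]|[f fi]].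
  pose up (k : K) : [set: K] := SigSub (mem_set (I : [set: K] k)).
  exists (fun k => exist A (val (f (up k))) (set_mem (valP (f (up k))))).
  move=> k k' [/val_inj e]; suff : up k = up k' by case.
  by apply: (inj (f := f)); rewrite ?in_setT.
pose g k := sval (f k); have gA : set_fun [set: K] A g by move=> k _; exact: svalP.
have : exists2 f : K -> U, set_fun setT A f & set_inj setT f.
  exists g => // k k' _ _ e; exact/fi/sval_inj.
by move/injfunPex => -[h]; exact: inj_card_le.
Qed.

(** * Ultralimits and finitely additive measures *)

Section Ultralimits.
Variables (R : realType) (I : Type) (U : set_system I).
Hypothesis UU : UltraFilter U.

(** For bounded [f] this supremum is the limit of [f] along the ultrafilter [U]. *)
Definition ulim (f : I -> R) : R := sup [set r | U [set i | r <= f i]].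

Lemma ulimP (f : I -> R) (e : R) : (forall i, 0 <= f i <= 1) -> 0 < e ->
  U [set i | `|f i - ulim f| < e].
Proof.
move=> f01 e0; set S := [set r | U [set i | r <= f i]].
have hS : has_sup S.
  split; first by exists 0; apply: filterS filterT => i _; case/andP: (f01 i).
  exists 1 => r Sr; have [i /= ri] := filter_ex Sr.
  by apply: le_trans ri _; case/andP: (f01 i).
have [r Sr er] := sup_adherent e0 hS.
have [H|H] := in_ultra_setVsetC [set i | ulim f + e / 2 <= f i] UU.
  have : ulim f + e / 2 <= ulim f by apply: sup_upper_bound.
  by lra.
near=> i; have ri : r <= f i by near: i.
have li : f i < ulim f + e / 2 by rewrite ltNge; apply/negP; near: i.
have {}er : ulim f - e < r by [].
by rewrite /= ltr_norml; apply/andP; split; lra.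
Unshelve. all: by end_near. Qed.

Lemma ulim_eq (f : I -> R) (a : R) : (forall i, 0 <= f i <= 1) ->
  (forall e, 0 < e -> exists2 i, `|f i - a| < e & `|f i - ulim f| < e) ->
  ulim f = a.
Proof.
move=> f01 H; apply/eqP; apply/negP => /negP ne.
have e0 : 0 < `|ulim f - a| / 2 by rewrite divr_gt0// normr_gt0 subr_eq0.
have [i h1 h2] := H _ e0; move: h1 h2 e0.
rewrite !ltr_norml => /andP[h1 h2] /andP[h3 h4].
by have [/ger0_norm E|/ltW/ler0_norm E] := leP 0 (ulim f - a);
  rewrite E in h1 h2 h3 h4 * => ?; lra.
Qed.

Lemma ulim_near (f : I -> R) (a : R) : (forall i, 0 <= f i <= 1) ->
  U [set i | f i = a] -> ulim f = a.
Proof.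
move=> f01 Ua; apply: ulim_eq => // e e0.
have [i [/= fia h]] := filter_ex (filterI Ua (ulimP f01 e0)).
by exists i => //; rewrite fia subrr normr0.
Qed.

Lemma ulim_ge (f : I -> R) (a : R) : (forall i, 0 <= f i <= 1) ->
  (forall i, a <= f i) -> a <= ulim f.
Proof.
move=> f01 af; rewrite leNgt; apply/negP => lt.
have e0 : 0 < a - ulim f by rewrite subr_gt0.
have [i /=] := filter_ex (ulimP f01 e0); rewrite ltr_norml => /andP[_ h].
by have := af i; lra.
Qed.

Lemma ulim_le (f : I -> R) (a : R) : (forall i, 0 <= f i <= 1) ->
  (forall i, f i <= a) -> ulim f <= a.
Proof.
move=> f01 af; rewrite leNgt; apply/negP => lt.
have e0 : 0 < ulim f - a by rewrite subr_gt0.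
have [i /=] := filter_ex (ulimP f01 e0); rewrite ltr_norml => /andP[h _].
by have := af i; lra.
Qed.

Lemma ulimD (f g : I -> R) : (forall i, 0 <= f i <= 1) ->
  (forall i, 0 <= g i <= 1) -> (forall i, 0 <= f i + g i <= 1) ->
  ulim (fun i => f i + g i) = ulim f + ulim g.
Proof.
move=> f01 g01 fg01; apply: ulim_eq => // e e0.
have e20 : 0 < e / 2 by rewrite divr_gt0.
have [i [[/= h1 h2] h3]] := filter_ex
  (filterI (filterI (ulimP f01 e20) (ulimP g01 e20)) (ulimP fg01 e0)).
exists i => //; move: h1 h2; rewrite !ltr_norml.
by move=> /andP[? ?] /andP[? ?]; apply/andP; split; lra.
Qed.

End Ultralimits.

Section FinitelyAdditive.
Variables (R : realType) (X : Type).
Implicit Types (mu nu : set X -> R) (D E : set X).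

Definition fa_measure mu : Prop :=
  (forall D, 0 <= mu D) /\
  (forall D E, D `&` E = set0 -> mu (D `|` E) = mu D + mu E).

Definition fa_probability mu : Prop := fa_measure mu /\ mu setT = 1.

Lemma fa_measureID mu D E : fa_measure mu ->
  mu D = mu (D `&` E) + mu (D `\` E).
Proof.
move=> [_ <-]; first by rewrite setUIDK.
by rewrite setDE setIACA setICr setI0.
Qed.

Lemma fa_measure0 mu : fa_measure mu -> mu set0 = 0.
Proof.
move=> mum; have := fa_measureID set0 set0 mum.
by rewrite set0I set0D; lra.
Qed.

Lemma fa_measure_le mu D E : fa_measure mu -> D `<=` E -> mu D <= mu E.
Proof.
move=> mum DE; rewrite (fa_measureID E D mum) (setIidr DE).
by have := mum.1 (E `\` D); lra.
Qed.

Lemma fa_measure_ulim (I : Type) (U : set_system I) (mu : I -> set X -> R) :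
  UltraFilter U -> (forall i, fa_measure (mu i)) -> (forall i, mu i setT <= 1) ->
  fa_measure (fun D => ulim U (fun i => mu i D)).
Proof.
move=> UU mum mu1; have b D i : 0 <= mu i D <= 1.
  rewrite (mum i).1 /=; apply: le_trans (mu1 i); exact: fa_measure_le.
split=> [D|D E DE]; first by apply: ulim_ge => // i; exact: (mum i).1.
rewrite -ulimD//; last by move=> i; rewrite -(mum i).2.
by congr (ulim _ _); apply/funext => i; rewrite (mum i).2.
Qed.

Lemma fa_probability01 mu D : fa_probability mu -> 0 <= mu D <= 1.
Proof.
move=> [mum mu1]; rewrite mum.1 /= -mu1; exact: fa_measure_le.
Qed.

Lemma fa_probability_ulim (I : Type) (U : set_system I) (mu : I -> set X -> R) :
  UltraFilter U -> (forall i, fa_probability (mu i)) ->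
  fa_probability (fun D => ulim U (fun i => mu i D)).
Proof.
move=> UU mup; split.
  by apply: fa_measure_ulim => i; case: (mup i) => // _ ->.
apply: ulim_near => [i|]; first exact: fa_probability01.
by apply: filterS filterT => i _; case: (mup i).
Qed.

Section Extension.
Variables (B : set (set X)) (mu : set X -> R).
Hypotheses (BT : B setT) (BI : forall D E, B D -> B E -> B (D `&` E))
  (BC : forall D, B D -> B (~` D)).
Hypotheses (mu_ge0 : forall D, B D -> 0 <= mu D) (muT : mu setT = 1)
  (muD : forall D E, B D -> B E -> D `&` E = set0 -> mu (D `|` E) = mu D + mu E).

Let BD D E : B D -> B E -> B (D `\` E).
Proof. by move=> BD BE; rewrite setDE; apply: BI => //; exact: BC. Qed.

Let muID D E : B D -> B E -> mu D = mu (D `&` E) + mu (D `\` E).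
Proof.
move=> HD HE; rewrite -muD ?setUIDK//; [exact: BI|exact: BD|].
by rewrite setDE setIACA setICr setI0.
Qed.

(* [nu] is a sum of point masses, one in each atom of the algebra generated by
   [A] and [l]. *)
Lemma fa_extension_finite (l : seq (set X)) (A : set X) : B A ->
  {in l, forall D, B D} ->
  exists nu, [/\ fa_measure nu, nu setT = mu A, nu (~` A) = 0 &
                 {in l, forall D, nu D = mu (A `&` D)}].
Proof.
elim: l A => [|D l IH] A BA Bl.
  have [[x Ax]|/nonemptyPn A0] := pselect (A !=set0).
    exists (fun E => if x \in E then mu A else 0); split=> //.
    - split=> [E|E F EF]; first by case: ifP => // _; exact: mu_ge0.
      rewrite in_setU; case: (boolP (x \in E)) => /= xE; last by rewrite add0r.
      rewrite ifF ?addr0//; apply/negbTE/negP => xF.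
      have : (E `&` F) x by split; apply: set_mem.
      by rewrite EF.
    - by rewrite in_setT.
    - by rewrite in_setC mem_set.
  have muA : mu A = 0 by have := muID BA BA; rewrite A0 setI0 set0D; lra.
  by exists (fun=> 0); split=> //; split=> // *; rewrite addr0.
have BDD : B D by apply: Bl; rewrite inE eqxx.
have Bl' : {in l, forall D, B D} by move=> E El; apply: Bl; rewrite inE El orbT.
have [nu1 [m1 T1 C1 l1]] := IH _ (BI BA BDD) Bl'.
have [nu2 [m2 T2 C2 l2]] := IH _ (BD BA BDD) Bl'.
have z1 E : E `<=` ~` (A `&` D) -> nu1 E = 0.
  move=> /(fa_measure_le m1); rewrite C1 => h; apply/eqP.
  by rewrite eq_le h m1.1.
have z2 E : E `<=` ~` (A `\` D) -> nu2 E = 0.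
  move=> /(fa_measure_le m2); rewrite C2 => h; apply/eqP.
  by rewrite eq_le h m2.1.
exists (fun E => nu1 E + nu2 E); split.
- split=> [E|E F EF]; first by rewrite addr_ge0 ?m1.1 ?m2.1.
  by rewrite m1.2 ?m2.2//; lra.
- by rewrite T1 T2 -muID.
- by rewrite z1 ?z2 ?addr0 => [|x NAx [/NAx]|x NAx [/NAx]].
move=> E; rewrite inE => /orP[/eqP ->|El].
  rewrite z2 ?addr0; last by move=> x Dx [].
  rewrite -T1 (fa_measureID setT D m1) setTI setTD.
  by rewrite [X in _ = _ + X]z1 ?addr0// => x NDx [].
rewrite l1// l2// [RHS](@muID _ D); [|by apply: BI => //; exact: Bl'|by []].
by rewrite !setDE; congr (mu _ + mu _); exact: setIAC.
Qed.

(** For each finite list of sets some probability agrees with [mu] on its members in [B]. The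
    ultralimit along an ultrafilter containing all cones of lists then agrees with [mu] on all of
    [B]. *)
Lemma fa_extension : exists2 nu, fa_probability nu & forall D, B D -> nu D = mu D.
Proof.
pose cone (l : seq (set X)) := [set s : seq (set X) | {subset l <= s}].
have PF : ProperFilter (filter_from setT cone).
  apply: filter_from_proper; last by move=> l _; exists l.
  apply: filter_from_filter; first by exists [::].
  move=> l l' _ _; exists (l ++ l') => // s H; split=> D Dl; apply: H;
    by rewrite mem_cat Dl ?orbT.
have [U [UU FU]] := ultraFilterLemma PF.
have H (l : seq (set X)) : exists nu, fa_probability nu /\
    forall D, D \in l -> B D -> nu D = mu D.
  have [D|nu [m1 T1 _ l1]] := @fa_extension_finite [seq D <- l | `[< B D >]] setT BT.
    by rewrite mem_filter => /andP[/asboolP].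
  exists nu; split=> [|D Dl BDD]; first by split; rewrite // T1.
  by rewrite l1 ?setTI// mem_filter Dl andbT; apply/asboolP.
have [nu nuP] := choice H.
exists (fun D => ulim U (fun l => nu l D)).
  by apply: fa_probability_ulim => l; case: (nuP l).
move=> D BDD; apply: ulim_near => [l|].
  by apply: fa_probability01; case: (nuP l).
apply: FU; exists [:: D] => // l /(_ D) Dl.
by apply: (nuP l).2 => //; apply: Dl; rewrite inE.
Qed.

End Extension.

End FinitelyAdditive.

(** * Consistent paths through an array of sets *)

Section ConsistentPaths.
Variables (R : realType) (X : Type) (B : nat -> set (set X)).
Variables (mu la : nat -> set X -> R) (E : nat -> nat -> set X).
Variables (w : nat) (eps : R).
Hypotheses (BT : forall i, B i setT)
  (BI : forall i D F, B i D -> B i F -> B i (D `&` F))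
  (BC : forall i D, B i D -> B i (~` D))
  (B_mono : forall i, B i `<=` B i.+1).
Hypotheses (w_gt0 : (0 < w)%N) (eps_gt0 : 0 < eps).
Hypotheses (mup : forall i, fa_probability (mu i))
  (mu_agree : forall i D, B i D -> mu i.+1 D = mu i D)
  (lam : forall i, fa_measure (la i))
  (la_le1 : forall i, la i setT <= 1) (la_eps : forall i, eps <= la i setT).
Hypotheses (EB : forall i j, (j < w)%N -> B i.+1 (E i j))
  (mu_E : forall i j D, (j < w)%N -> B i D ->
     la i D / w%:R <= mu i.+1 (D `&` E i j)).

Let B_le i j D : (i <= j)%N -> B i D -> B j D.
Proof.
elim: j => [|j IH]; first by rewrite leqn0 => /eqP ->.
rewrite leq_eqVlt => /orP[/eqP->//|]; rewrite ltnS => ij /(IH ij).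
exact: B_mono.
Qed.

Let mu_le i j D : (i <= j)%N -> B i D -> mu j D = mu i D.
Proof.
elim: j => [|j IH]; first by rewrite leqn0 => /eqP ->.
rewrite leq_eqVlt => /orP[/eqP->//|]; rewrite ltnS => ij BD.
by rewrite mu_agree ?IH//; exact: B_le BD.
Qed.

Let la01 i D : 0 <= la i D <= 1.
Proof. by rewrite (lam i).1 (le_trans _ (la_le1 i))//; exact: fa_measure_le. Qed.

(** Rows are picked so that, for every path through those already chosen, the intersection with [D0]
    keeps [l]-measure at least [r k]. As [r N] is positive, no path of length [N] has empty
    intersection. *)
Lemma consistent_paths (N : nat) : exists h : nat -> nat,
  forall eta : nat -> nat, (forall l, (eta l < w)%N) ->
  exists x, forall l, (l < N)%N -> E (h l) (eta l) x.
Proof.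
have e0 : 0 < eps by [].
pose tail n := [set i | (n <= i)%N].
have PF : ProperFilter (filter_from setT tail).
  apply: filter_from_proper; last by move=> n _; exists n; exact: leqnn.
have [U [UU FU]] := ultraFilterLemma PF.
have Uge n : U (tail n) by apply: FU; exists n.
pose m D := ulim U (fun i => mu i D); pose l D := ulim U (fun i => la i D).
have mp : fa_probability m by apply: fa_probability_ulim.
have lm : fa_measure l by apply: fa_measure_ulim.
have mE i D : B i D -> m D = mu i D.
  move=> BD; apply: ulim_near => [j|]; first exact: fa_probability01.
  by apply: filterS (Uge i) => j ij /=; exact: mu_le.
have leps : eps <= l setT by apply: ulim_ge => // i.
have l_le1 D : l D <= 1.
  by apply: ulim_le => // i; case/andP: (la01 i D).
have eps_le1 : eps <= 1 by apply: le_trans leps (l_le1 _).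
pose BB D := exists i, B i D.
have w0 : 0 < w%:R :> R by rewrite ltr0n.
have w1 : 1 <= w%:R :> R by rewrite ler1n.
(* With this [c] the value of [l - c * m] at the whole space is at least [eps / 2], which keeps
   [l D0] away from zero. *)
have [c cE] : exists c, c = eps / 2 by exists (eps / 2).
have c0 : 0 < c by lra.
have cw0 : 0 < c / w%:R by rewrite divr_gt0.
have cw : c / w%:R <= c by rewrite ler_pdivrMr// ler_peMr// ltW.
(* A row costs a factor [c / w]; the extra factor [1 / 2] in [q] absorbs the errors of size [dl]. *)
have [q qE] : exists q, q = c / w%:R / 2 by exists (c / w%:R / 2).
have q0 : 0 < q by lra.
have q1 : q <= 1 by lra.
pose r k : R := q ^+ k * (eps / 4).
have r0 k : 0 < r k by rewrite mulr_gt0 ?exprn_gt0//; lra.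
have r0E : r 0%N = eps / 4 by rewrite /r expr0 mul1r.
have rS k : r k.+1 = q * r k by rewrite /r exprS -!mulrA.
have r_le k k' : (k <= k')%N -> r k' <= r k.
  by move=> kk'; rewrite ler_wpM2r//; [lra|apply: ler_wiXn2l => //; exact: ltW].
(* The error in one step is at most [2 * dl], half of the last threshold. *)
pose dl := r N / 4.
have dl0 : 0 < dl by rewrite divr_gt0.
have dl1 : dl <= eps / 16.
  by have := r_le 0%N N isT; rewrite r0E /dl; lra.
pose S := [set l D - c * m D | D in BB].
have hS : has_sup S.
  split; first by exists (l setT - c * m setT), setT => //; exists 0%N.
  exists 1 => _ [D _ <-]; have := l_le1 D.
  have : 0 <= c * m D by rewrite mulr_ge0 ?mp.1.1// ltW.
  by lra.
have [_ [D0 BD0 <-] D0S] := sup_adherent dl0 hS.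
have maxD0 D : BB D -> l D - c * m D < l D0 - c * m D0 + dl.
  move=> BD; suff : l D - c * m D <= sup S by lra.
  by apply: sup_upper_bound => //; exists D.
(* Otherwise removing [D] from [D0] would increase [l - c * m] by more than [dl]. *)
have l_ge D : BB D -> D `<=` D0 -> c * m D - dl <= l D.
  move=> [i Bi] DD0; have [j Bj] := BD0.
  have : BB (D0 `\` D).
    exists (maxn i j); rewrite setDE; apply: BI; last apply: BC.
      by apply: B_le Bj; exact: leq_maxr.
    by apply: B_le Bi; exact: leq_maxl.
  move=> /maxD0; rewrite (fa_measureID D0 D lm) (fa_measureID D0 D mp.1).
  by rewrite (setIidr DD0) mulrDr; lra.
have lD0 : r 0%N <= l D0.
  have := maxD0 setT (ex_intro _ 0%N (BT 0)); rewrite mp.2 r0E.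
  have : 0 <= c * m D0 by rewrite mulr_ge0 ?mp.1.1// ltW.
  by lra.
(* By [l_ge] and [mu_E] the new set has [l]-measure at least [c / w * (l G - dl) - dl], which is at
   least [r k.+1]. *)
have step (k i : nat) (G : set X) (j : nat) : (k < N)%N -> (j < w)%N -> B i G ->
    G `<=` D0 -> r k <= l G -> l G - dl <= la i G ->
    [/\ BB (G `&` E i j), G `&` E i j `<=` D0 & r k.+1 <= l (G `&` E i j)].
  move=> kN jw BG GD0 rG laG.
  have BGE : B i.+1 (G `&` E i j) by apply: BI; [exact: B_mono|exact: EB].
  have GED0 : G `&` E i j `<=` D0 by move=> x [/GD0].
  split=> //; first by exists i.+1.
  have h1 := l_ge _ (ex_intro _ _ BGE) GED0.
  have h2 : c / w%:R * la i G <= c * m (G `&` E i j).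
    by rewrite (mE _ _ BGE) -mulrA ler_pM2l// mulrC; exact: mu_E.
  have h3 : c / w%:R * (l G - dl) <= c / w%:R * la i G by rewrite ler_pM2l.
  have h4 : c / w%:R * dl <= dl by rewrite ler_piMl// ?ltW//; lra.
  have h5 : c / w%:R * r k <= c / w%:R * l G by rewrite ler_pM2l.
  have h6 : r N <= r k.+1 := r_le _ _ kN.
  have h7 : c / w%:R * r k = 2 * r k.+1 by rewrite rS qE; lra.
  have dE : dl = r N / 4 by [].
  by move: h3; rewrite mulrBr; lra.
(* One row has to serve all current sets; as these are finitely many, almost every row along [U]
   does. *)
have near_seq (gs : seq (set X)) : {in gs, forall G, BB G} ->
    U [set i | {in gs, forall G, B i G /\ l G - dl <= la i G}].
  elim: gs => [|G gs IH] Bgs; first by apply: filterS filterT => i _ G.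
  have [i Bi] : BB G by apply: Bgs; rewrite inE eqxx.
  have {}IH := IH (fun F Fgs => Bgs F (mem_behead (s := G :: gs) Fgs)).
  have lG := ulimP UU (fun i => la01 i G) dl0.
  apply: filterS (filterI (filterI (Uge i) lG) IH) => j [[/= ij lj] IHj] F.
  rewrite inE => /orP[/eqP ->|/IHj//]; split; first exact: B_le Bi.
  by move: lj; rewrite ltr_norml -/(l G) => /andP[]; lra.
(* [gs] collects the intersections of [D0] with all paths through the first [k] chosen rows. *)
suff H k : (k <= N)%N -> exists (h : nat -> nat) (gs : seq (set X)),
    {in gs, forall G, [/\ BB G, G `<=` D0 & r k <= l G]} /\
    forall eta : nat -> nat, (forall l, (eta l < w)%N) ->
      exists2 G, G \in gs &
        forall x, G x -> forall l, (l < k)%N -> E (h l) (eta l) x.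
  have [h [gs [gsP H']]] := H N (leqnn N); exists h => eta etaw.
  have [G /gsP[_ _ rG] GE] := H' _ etaw.
  have [[x Gx]|/nonemptyPn G0] := pselect (G !=set0).
    by exists x => k kN; exact: GE.
  by move: rG; rewrite G0 (fa_measure0 lm) leNgt r0.
elim: k => [_|k IH kN].
  exists id, [:: D0]; split=> [G|eta _]; first by rewrite inE => /eqP ->; split.
  by exists D0 => //; rewrite inE.
have [h [gs [gsP gsE]]] := IH (ltnW kN).
have [G /gsP[]//|i /= iP] := filter_ex (@near_seq gs _).
exists (fun a => if a == k then i else h a).
exists [seq G `&` E i j | G <- gs, j <- iota 0 w]; split.
  move=> _ /allpairsP[[G j] /= [Ggs + ->]]; rewrite mem_iota add0n => jw.
  have [BG GD0 rG] := gsP _ Ggs; have [BiG lG] := iP _ Ggs.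
  exact: step.
move=> eta etaw; have [G Ggs GE] := gsE _ etaw.
exists (G `&` E i (eta k)).
  by apply: allpairs_f => //; rewrite mem_iota add0n etaw.
move=> x [Gx Ex] a; rewrite ltnS leq_eqVlt; case: eqP => [->//|_ /= ak].
exact: GE.
Qed.

End ConsistentPaths.

(** * Formulas and definable sets *)

Section Formulas.
Variable L : language.

Fixpoint trename V W (f : V -> W) (t : term L V) : term L W :=
  match t with
  | tvar x => tvar (f x)
  | tapp g ts => tapp g (fun i => trename f (ts i))
  end.

Fixpoint frename V W (f : V -> W) (phi : formula L V) : formula L W :=
  match phi with
  | fbot => fbot
  | feq s t => feq (trename f s) (trename f t)
  | fatom r ts => fatom r (fun i => trename f (ts i))
  | fimp p q => fimp (frename f p) (frename f q)
  | fall p => fall (frename (omap f) p)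
  end.

Definition ftrue V : formula L V := fimp fbot fbot.
Definition fand V (p q : formula L V) : formula L V := fnot (fimp p (fnot q)).
Definition fconj V (s : seq (formula L V)) := foldr (@fand V) (ftrue V) s.
Definition fex V (p : formula L (option V)) : formula L V := fnot (fall (fnot p)).

(** Quantifiers bind [None], so a tuple is bound one coordinate at a time, the first coordinate
    becoming [None]. *)
Definition shift_var n W (x : 'I_n.+1 + W) : option ('I_n + W) :=
  match x with
  | inl i => omap inl (unlift ord0 i)
  | inr y => Some (inr y)
  end.

Definition drop_var W (x : 'I_0 + W) : W :=
  match x with
  | inl i => False_rect W (notF (ltn_ord i))
  | inr y => y
  end.

Fixpoint fexs n W : formula L ('I_n + W) -> formula L W :=
  match n with
  | 0 => fun phi => frename (@drop_var W) phi
  | n'.+1 => fun phi => fexs (fex (frename (@shift_var n' W) phi))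
  end.

Definition in_params n m W (y : 'I_m -> W) (z : 'I_n + 'I_m) : 'I_n + W :=
  match z with inl i => inl i | inr j => inr (y j) end.

(* "exists x, phi(x, y_i) for all i in s", the y_i being tuples of variables. *)
Definition fjoint n m W (I : Type) (phi : formula L ('I_n + 'I_m))
    (y : I -> 'I_m -> W) (s : seq I) : formula L W :=
  fexs (fconj [seq frename (in_params (y i)) phi | i <- s]).

Section Sat.
Variable C : structure L.

Definition joinval n W (a : 'I_n -> C) (v : W -> C) (x : 'I_n + W) : C :=
  match x with inl i => a i | inr y => v y end.

Lemma eval_trename V W (f : V -> W) (v : W -> C) t :
  eval v (trename f t) = eval (v \o f) t.
Proof.
by elim: t => //= g ts IH; congr (fint C g _); apply/funext.
Qed.

Lemma sat_frename V W (f : V -> W) (v : W -> C) phi :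
  sat v (frename f phi) <-> sat (v \o f) phi.
Proof.
elim: phi W f v => {V}[V|V s t|V r ts|V p IHp q IHq|V p IH] W f v //=.
- by rewrite !eval_trename.
- by under eq_fun do rewrite eval_trename.
- by split=> H /IHp /H /IHq.
- have E c : oapp v c \o omap f = oapp (v \o f) c.
    by apply/funext => -[].
  by split=> H c; [rewrite -E; apply/IH|apply/IH; rewrite E].
Qed.

Lemma sat_fnot V (v : V -> C) p : sat v (fnot p) <-> ~ sat v p.
Proof. by []. Qed.

Lemma sat_fand V (v : V -> C) p q : sat v (fand p q) <-> sat v p /\ sat v q.
Proof.
split=> /= [H|[Hp Hq]]; last by apply.
by split; apply: contrapT => N; apply: H => // Hp Hq; exact: N.
Qed.

Lemma sat_fconj V (v : V -> C) (I : eqType) (F : I -> formula L V) (s : seq I) :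
  sat v (fconj [seq F i | i <- s]) <-> {in s, forall i, sat v (F i)}.
Proof.
elim: s => [|i s IH]; first by split=> // _ [].
rewrite (_ : fconj _ = fand (F i) (fconj [seq F i | i <- s]))//.
rewrite sat_fand IH; split=> [[Hi Hs] j|H].
  by rewrite inE => /orP[/eqP ->|/Hs].
by split=> [|j js]; apply: H; rewrite inE ?eqxx ?js ?orbT.
Qed.

Lemma sat_fex V (v : V -> C) p : sat v (fex p) <-> exists c, sat (oapp v c) p.
Proof. by split=> /= [/existsNP[c /contrapT H]|[c H] N]; [exists c|exact: (N c)]. Qed.

Lemma sat_fexs n W (v : W -> C) (phi : formula L ('I_n + W)) :
  sat v (fexs phi) <-> exists a, sat (joinval a v) phi.
Proof.
elim: n phi => [|n IH] phi /=.
  have E a : v \o @drop_var W = joinval a v.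
    by apply/funext => -[[]|].
  rewrite sat_frename; split=> [|[a]]; last by rewrite (E a).
  pose a0 (i : 'I_0) : C := False_rect C (notF (ltn_ord i)).
  by rewrite (E a0) => H; exists a0.
rewrite IH; split=> [[a /sat_fex[c /sat_frename H]]|[a H]].
  exists (fun i => oapp a c (unlift ord0 i)); move: H; congr sat.
  by apply/funext => -[i|y] //=; case: (unlift ord0 i).
exists (fun i => a (lift ord0 i)); apply/sat_fex; exists (a ord0).
apply/sat_frename; move: H; congr sat; apply/funext => -[i|y] //=.
by case: unliftP => [j ->|->].
Qed.

Lemma sat_fjoint n m W (I : eqType) (phi : formula L ('I_n + 'I_m))
    (y : I -> 'I_m -> W) (s : seq I) (v : W -> C) :
  sat v (fjoint phi y s) <->
  exists a, {in s, forall i, defset phi (v \o y i) a}.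
Proof.
rewrite sat_fexs; split=> -[a H]; exists a.
  move=> i si; move/sat_fconj : H => /(_ i si)/sat_frename.
  by rewrite /defset /=; congr sat; apply/funext => -[].
apply/sat_fconj => i si; apply/sat_frename; have := H i si.
by rewrite /defset /=; congr sat; apply/funext => -[].
Qed.

Lemma eval_automorphism (s : C -> C) V (v : V -> C) (t : term L V) :
  automorphism s -> eval (s \o v) t = s (eval v t).
Proof.
move=> [_ sf _]; elim: t => //= f ts IH; rewrite sf; congr (fint C f _).
exact/funext.
Qed.

Lemma sat_automorphism (s : C -> C) V (v : V -> C) (phi : formula L V) :
  automorphism s -> sat (s \o v) phi <-> sat v phi.
Proof.
move=> sa; elim: phi v => {V}[V|V t u|V r ts|V p IHp q IHq|V p IH] v //=.
- rewrite !eval_automorphism//; split=> [|->//].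
  by case: sa => /bij_inj si _ _ /si.
- under eq_fun do rewrite eval_automorphism//.
  by case: sa => _ _ /(_ r) <-.
- by rewrite IHp IHq.
- have [[t st ts] _ _] := sa.
  have E c : oapp (s \o v) (s c) = s \o oapp v c by apply/funext => -[].
  split=> H c; first by apply/IH; rewrite -E.
  by rewrite -(ts c) E; apply/IH.
Qed.

End Sat.
End Formulas.

Section DefinableSets.
Variables (L : language) (C : structure L) (n : nat).
Implicit Types (A : set C) (D E : set ('I_n -> C)).

Lemma definable_mono A A' D : A `<=` A' -> definable A D -> definable A' D.
Proof. by move=> AA' [m [phi [b [bA ->]]]]; exists m, phi, b; split=> // j; exact: AA'. Qed.

Lemma definable_defset A m (phi : formula L ('I_n + 'I_m)) b :
  (forall j, A (b j)) -> definable A (defset phi b).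
Proof. by move=> bA; exists m, phi, b. Qed.

Lemma definableT A : definable A [set: 'I_n -> C].
Proof.
exists 0%N, (ftrue L _), (fun i : 'I_0 => False_rect C (notF (ltn_ord i))).
split=> [[]//|]; apply/seteqP; split=> // a _; exact: id.
Qed.

Lemma definableC A D : definable A D -> definable A (~` D).
Proof. by move=> [m [phi [b [bA ->]]]]; exists m, (fnot phi), b. Qed.

Lemma definableI A D E : definable A D -> definable A E -> definable A (D `&` E).
Proof.
move=> [m [phi [b [bA ->]]]] [m' [phi' [b' [bA' ->]]]].
exists (m + m')%N, (fand (frename (in_params (@lshift m m')) phi)
                         (frename (in_params (@rshift m m')) phi')).
pose bb (j : 'I_(m + m')) := match fintype.split j with inl i => b i | inr i => b' i end.
exists bb; split=> [j|]; first by rewrite /bb; case: fintype.split.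
have E1 a : valpair a bb \o in_params (@lshift m m') = valpair a b.
  by apply/funext => -[i|i] //=; rewrite /bb (unsplitK (inl i)).
have E2 a : valpair a bb \o in_params (@rshift m m') = valpair a b'.
  by apply/funext => -[i|i] //=; rewrite /bb (unsplitK (inr i)).
apply/seteqP; split=> a; rewrite /defset /=.
  by move=> [H1 H2]; apply/sat_fand; split; apply/sat_frename; rewrite ?E1 ?E2.
by move/sat_fand => -[/sat_frename + /sat_frename]; rewrite E1 E2.
Qed.

End DefinableSets.

Section Dividing.
Variables (L : language) (C : structure L).

Lemma consistent_range n (D : nat -> set ('I_n -> C)) :
  consistent (range D) <-> forall N, exists a, forall i, (i < N)%N -> D i a.
Proof.
split=> [H N|H F Ffin FD].
  have [||a aP] := H [set D i | i in `I_N].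
  - exact/finite_image/finite_II.
  - by move=> _ [i _ <-]; exists i.
  - by exists a => i iN; apply: aP; exists i.
have [N NP] : exists N, forall E, F E -> exists2 i, (i < N)%N & D i = E.
  have [s sF] := (finite_seqP F).1 Ffin; rewrite {}sF {F Ffin} in FD *.
  elim: s FD => [|E s IH] FD; first by exists 0%N.
  have [|N NP] := IH; first by move=> G /= Gs; apply: FD; rewrite /= inE Gs orbT.
  have [|i _ iE] := FD E; first by rewrite /= inE eqxx.
  exists (maxn i.+1 N) => G /=; rewrite inE => /orP[/eqP ->|/NP[j jN <-]].
    by exists i => //; rewrite leq_max leqnn.
  by exists j => //; rewrite leq_max jN orbT.
have [a aP] := H N; exists a => E /NP[i iN <-]; exact: aP.
Qed.

Definition kdivides n m (A : set C) (phi : formula L ('I_n + 'I_m)) (k : nat)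
    (b : 'I_m -> C) : Prop :=
  exists bs : nat -> 'I_m -> C,
    [/\ indiscernible A bs, bs 0%N = b &
        k_inconsistent k (fun j => defset phi (bs j))].

Lemma indiscernible_mono m (A A' : set C) (bs : nat -> 'I_m -> C) :
  A `<=` A' -> indiscernible A' bs -> indiscernible A bs.
Proof. by move=> AA' H k p psi c i j cA; apply: H => q; exact: AA'. Qed.

Lemma kdivides_mono n m (A A' : set C) (phi : formula L ('I_n + 'I_m)) k b :
  A `<=` A' -> kdivides A' phi k b -> kdivides A phi k b.
Proof.
by move=> AA' [bs [ib b0 ki]]; exists bs; split=> //; exact: indiscernible_mono ib.
Qed.

(** Inconsistency of an initial segment of length [k] passes by indiscernibility to every increasing
    [k]-tuple of indices, and distinct indices can be sorted. *)
Lemma divides_kdivides n m (A : set C) (phi : formula L ('I_n + 'I_m)) b :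
  divides A phi b -> exists k, kdivides A phi k b.
Proof.
move=> [bs [ib b0 /consistent_range/existsNP[k Hk]]].
exists k, bs; split=> // s us sk [a aP]; apply: Hk.
pose t := sort leq s.
have tk : size t = k by rewrite size_sort.
have tsorted : sorted ltn t.
  by rewrite ltn_sorted_uniq_leq sort_uniq us sort_sorted//; exact: leq_total.
pose y (i : 'I_k) (j : 'I_m) : 'I_k * 'I_m + 'I_0 := inl (i, j).
pose psi := fjoint phi y (enum 'I_k).
pose c (q : 'I_0) : C := False_rect C (notF (ltn_ord q)).
have [|||_ H] := ib k 0%N psi c (fun r => val r) (fun r => nth 0%N t r).
- by case.
- by [].
- move=> r r' rr'; apply: (sorted_ltn_nth ltn_trans) => //;
    by rewrite inE tk ltn_ord.
have /H/sat_fjoint[x xP] : sat (seqval bs (fun r => nth 0%N t r) c) psi.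
  apply/sat_fjoint; exists a => i _; apply: aP.
  by rewrite -(mem_sort leq) mem_nth// tk.
by exists x => i ik; exact: (xP (Ordinal ik) (mem_enum _ _)).
Qed.

End Dividing.

(** * Countable compactness and TP2 arrays *)

Section Small.
Variables (K : Type) (K_unc : card_lt [set: nat] [set: K]).

Lemma embeds_nat_uncountable : embeds nat K.
Proof.
have [//|[f fi]] := embeds_total nat K; exfalso; apply: K_unc.
by apply/card_leTE; exists (fun k => exist _ (f k) I) => k k' [/fi].
Qed.

Lemma small_finite L (C : structure L) (A : set C) : finite_set A -> small K A.
Proof.
move=> Afin /card_leTE KA; have := Afin; apply/infiniteP/card_leTE.
exact: embeds_trans embeds_nat_uncountable KA.
Qed.

Lemma small_setU L (C : structure L) (A B : set C) :
  small K A -> small K B -> small K (A `|` B).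
Proof.
move=> sA sB /card_leTE KAB.
have : embeds K ({x | A x} + {x | B x}).
  apply: embeds_trans KAB _.
  have H (u : {x | (A `|` B) x}) : exists z : {x | A x} + {x | B x},
      sval u = match z with inl a => sval a | inr b => sval b end.
    case: u => x /= [Ax|Bx]; [by exists (inl (exist _ x Ax))|].
    by exists (inr (exist _ x Bx)).
  have [f fP] := choice H; exists f => u v e; apply: sval_inj.
  by rewrite /= !fP e.
by move=> /(embeds_sum embeds_nat_uncountable)[] /card_leTE; [exact: sA|exact: sB].
Qed.

End Small.

Section Compactness.
Variables (L : language) (C : structure L).

(** A term uses finitely many variables; [e] measures them by numbers, because [V] is arbitrary and
    grows under quantifiers. *)
Lemma eval_bound V (e : V -> nat) (t : term L V) : exists B,
  forall v v' : V -> C, (forall x, (e x < B)%N -> v x = v' x) ->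
    eval v t = eval v' t.
Proof.
elim: t => [x|f ts IH]; first by exists (e x).+1 => v v' /(_ x) /= ->.
have [B BP] := choice IH; exists (\max_i B i) => v v' H /=.
congr (fint C f _); apply/funext => i; apply: BP => x xB; apply: H.
exact: leq_trans xB (leq_bigmax i).
Qed.

Lemma sat_bound V (e : V -> nat) (phi : formula L V) : exists B,
  forall v v' : V -> C, (forall x, (e x < B)%N -> v x = v' x) ->
    sat v phi <-> sat v' phi.
Proof.
elim: phi e => {V}[V|V s t|V r ts|V p IHp q IHq|V p IH] e /=.
- by exists 0%N.
- have [B1 H1] := eval_bound e s; have [B2 H2] := eval_bound e t.
  exists (maxn B1 B2) => v v' H.
  rewrite (H1 v v') ?(H2 v v')// => x xB; apply: H;
    by rewrite leq_max xB ?orbT.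
- have [B BP] := choice (fun i => eval_bound e (ts i)).
  exists (\max_i B i) => v v' H.
  suff -> : (fun i => eval v (ts i)) = (fun i => eval v' (ts i)) by [].
  apply/funext => i; apply: BP => x xB; apply: H.
  exact: leq_trans xB (leq_bigmax i).
- have [B1 H1] := IHp e; have [B2 H2] := IHq e.
  exists (maxn B1 B2) => v v' H.
  by rewrite (H1 v v') ?(H2 v v')// => x xB; apply: H; rewrite leq_max xB ?orbT.
(* The bound variable may share the number [0] with another one: [e] need not be injective. *)
- have [B HB] := IH (oapp e 0%N); exists B => v v' H.
  have Hc c : sat (oapp v c) p <-> sat (oapp v' c) p.
    by apply: HB => -[x|] //= xB; rewrite H.
  by split=> Hp c; apply/Hc.
Qed.

Section Step.
Variables (K : Type) (K_unc : card_lt [set: nat] [set: K]) (Csat : saturated K C).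
Variables (I : eqType) (Gam : I -> formula L nat).

Definition extendable (t : nat) (u : nat -> C) : Prop := forall s : seq I,
  exists v, (forall i, (i < t)%N -> v i = u i) /\ {in s, forall i, sat v (Gam i)}.

(** The values at [t] compatible with a finite part of [Gam] form a set definable over the first [t]
    values. Concatenating lists shows that these sets are finitely consistent, so saturation over a
    finite set applies. *)
Lemma extendable_step t u : extendable t u ->
  exists y, extendable t.+1 (fun i => if i == t then y else u i).
Proof.
move=> ext.
pose D (s : seq I) : set ('I_1 -> C) := [set y | exists v : nat -> C,
  [/\ forall i, (i < t)%N -> v i = u i, v t = y ord0 &
      {in s, forall i, sat v (Gam i)}]].
pose A := [set u i | i in `I_t].
have Ddef s : definable A (D s).
  pose theta := fconj [seq Gam i | i <- s].
  have [B BP] := sat_bound id theta.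
  (* Variables below [t] become parameters, [t] becomes the free variable, and the others are
     quantified. Those beyond [B] may be merged by [inord], as [theta] does not see them. *)
  pose rho i : 'I_B.+1 + ('I_1 + 'I_t) := if insub i is Some j then inr (inr j)
    else if i == t then inr (inl ord0) else inl (inord i).
  exists t, (fexs (frename rho theta)), (fun j => u j); split.
    by move=> j; exists j => //=.
  have rho_lt y (a : 'I_B.+1 -> C) i : (i < t)%N ->
      joinval a (valpair y (fun j => u j)) (rho i) = u i.
    by move=> it; rewrite /rho insubT.
  have rho_eq y (a : 'I_B.+1 -> C) :
      joinval a (valpair y (fun j : 'I_t => u j)) (rho t) = y ord0.
    by rewrite /rho insubF ?ltnn// eqxx.
  apply/seteqP; split=> y; rewrite /defset [X in X -> _]/mkset.
    move=> [v [vu vt /sat_fconj Hs]]; apply/(sat_fexs (valpair y _)); exists (fun i => v i).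
    apply/sat_frename; apply: (iffLR (BP v _ _) Hs) => i /= iB.
    have [it|ti|->] := ltngtP i t; last by rewrite rho_eq.
      by rewrite rho_lt// vu.
    rewrite /rho insubF; last by rewrite ltnNge (ltnW ti).
    by rewrite gtn_eqF//= inordK// ltnW.
  move=> /sat_fexs[a /sat_frename/sat_fconj H].
  exists (joinval a (valpair y (fun j : 'I_t => u j)) \o rho); split=> //.
    by move=> i it /=; rewrite rho_lt.
  by rewrite /= rho_eq.
have A_small : small K A by apply/small_finite/finite_image/finite_II.
have [||y yP] := Csat A_small (p := range D).
- by move=> _ [s _ <-].
- move=> F Ffin FD.
  have [S SP] : exists S, forall E, F E -> D S `<=` E.
    have [l lF] := (finite_seqP F).1 Ffin; rewrite {}lF {F Ffin} in FD *.
    elim: l FD => [|E l IH] FD; first by exists [::].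
    have [|S SP] := IH; first by move=> G /= Gs; apply: FD; rewrite /= inE Gs orbT.
    have [|s _ sE] := FD E; first by rewrite /= inE eqxx.
    exists (s ++ S) => G /=; rewrite inE => /orP[/eqP ->|/SP SG].
      rewrite -sE => y [v [h1 h2 h3]]; exists v; split=> // i si.
      by apply: h3; rewrite mem_cat si.
    apply: subset_trans SG => y [v [h1 h2 h3]]; exists v; split=> // i si.
    by apply: h3; rewrite mem_cat si orbT.
  have [v [vu vS]] := ext S.
  by exists (fun=> v t) => E /SP; apply; exists v.
exists (y ord0) => s; have [|v [vu vt vs]] := yP (D s); first by exists s.
exists v; split=> // i; rewrite ltnS leq_eqVlt.
by case: eqP => [->//|_ /= it]; exact: vu.
Qed.

(** Values are chosen one at a time, each over finitely many parameters. A formula sees only an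
    initial segment of them, so the limit assignment satisfies all of [Gam]. *)
Lemma countable_compactness :
  (forall s : seq I, exists v : nat -> C, {in s, forall i, sat v (Gam i)}) ->
  exists v : nat -> C, forall i, sat v (Gam i).
Proof.
move=> fs; have [c0] := dom_inhabited C.
have H (p : nat * (nat -> C)) : exists y, extendable p.1 p.2 ->
    extendable p.1.+1 (fun i => if i == p.1 then y else p.2 i).
  have [ext|N] := pselect (extendable p.1 p.2); last by exists c0.
  by have [y yP] := extendable_step ext; exists y.
have [nxt nxtP] := choice H.
pose fix u t : nat -> C := if t is t'.+1 then
  fun i => if i == t' then nxt (t', u t') else u t' i else fun=> c0.
have uext t : extendable t (u t).
  elim: t => [|t IH]; last exact: (nxtP (t, u t)).
  by move=> s; have [v vs] := fs s; exists v.
pose v i := u i.+1 i.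
have uv t i : (i < t)%N -> u t i = v i.
  elim: t => // t IH; rewrite ltnS leq_eqVlt => /orP[/eqP -> //|it].
  by rewrite /= (ltn_eqF it) IH.
exists v => i; have [B BP] := sat_bound id (Gam i).
have [v' [v'u v'i]] := uext B [:: i].
apply: (iffLR (BP v' _ _) (v'i i (mem_head _ _))) => j jB.
by rewrite v'u// uv.
Qed.

End Step.

(** Only the [N] by [N] corner is asked to have consistent paths, while the rows stay infinite: this
    suits measures averaged over finitely many conjugates. *)
Definition finite_array n m (phi : formula L ('I_n + 'I_m)) (k N : nat)
    (a : nat -> nat -> 'I_m -> C) : Prop :=
  (forall i, k_inconsistent k (fun j => defset phi (a i j))) /\
  forall eta : nat -> nat, (forall i, (eta i < N)%N) ->
    exists x, forall i, (i < N)%N -> defset phi (a i (eta i)) x.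

(** The entries of an array are countably many variables; consistency of finite paths and
    [k]-inconsistency of rows are expressed by formulas in them, so countable compactness
    applies. *)
Lemma finite_arrays_TP2 (K : Type) n m (phi : formula L ('I_n + 'I_m)) k :
  card_lt [set: nat] [set: K] -> saturated K C ->
  (forall N, (0 < N)%N -> exists a, finite_array phi k N a) -> TP2 C phi.
Proof.
move=> K_unc Csat arr.
pose idx (i j : nat) (s : 'I_m) : nat := pickle (i, j, val s).
pose row (p : nat * seq nat) := fjoint phi (idx p.1) p.2.
pose path (eta : seq nat) :=
  fjoint phi (fun i => idx i (nth 0%N eta i)) (iota 0 (size eta)).
pose Gam (g : (nat * seq nat) + seq nat) := match g with
  | inl p => if uniq p.2 && (size p.2 == k) then fnot (row p) else ftrue L nat
  | inr eta => path eta end.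
have [|v vP] := countable_compactness K_unc Csat (Gam := Gam).
  move=> S.
  (* Bounds the length and the entries of the paths in [S], hence the corner that is needed. *)
  pose rk (g : (nat * seq nat) + seq nat) := if g is inr eta then
    maxn (size eta) (\max_(x <- eta) x) else 0%N.
  have [//|a [a1 a2]] := arr (\max_(g <- S) rk g).+1.
  have [c0] := dom_inhabited C.
  pose v q : C := if unpickle q is Some (i, j, s) then
    if insub s is Some s' then a i j s' else c0 else c0.
  have vE i j : v \o idx i j = a i j.
    by apply/funext => s; rewrite /= /v /idx pickleK valK.
  exists v => -[[i s] _|eta etaS] /=.
    case: ifP => [/andP[us /eqP sk]|_]; last exact: id.
    apply/sat_fnot => /sat_fjoint[x xP].
    by apply: (a1 i s us sk); exists x => j /xP; rewrite vE.
  apply/sat_fjoint.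
  have rk_le : (rk (inr eta) <= \max_(g <- S) rk g)%N by apply: leq_bigmax_seq.
  have [i|x xP] := a2 (nth 0%N eta).
    rewrite ltnS; apply: leq_trans rk_le => /=.
    have [ie|ie] := ltnP i (size eta); last by rewrite nth_default.
    rewrite leq_max; apply/orP; right; apply: leq_bigmax_seq => //.
    exact: mem_nth.
  exists x => i; rewrite mem_iota add0n vE => ie; apply: xP.
  rewrite ltnS; apply: leq_trans rk_le; rewrite leq_max; apply/orP; left.
  exact: ltnW.
exists (fun i j => v \o idx i j), k; split=> [eta|i].
  apply/consistent_range => N.
  have /sat_fjoint[x xP] := vP (inr (mkseq eta N)).
  exists x => i iN; have := xP i; rewrite size_mkseq mem_iota add0n iN nth_mkseq//.
  exact.
move=> s us sk [x xP]; have := vP (inl (i, s)); rewrite /Gam us sk eqxx.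
by apply; apply/sat_fjoint; exists x.
Qed.

End Compactness.

(** * Measures and dividing instances of one formula *)

Section Conjugates.
Variables (L : language) (C : structure L) (K : Type).
Hypotheses (K_unc : card_lt [set: nat] [set: K])
  (Chom : strongly_homogeneous K C).

(** All members of the sequence have the same type over [A], so the map fixing [A] and sending
    [bs 0] to [bs j] is elementary on a small set and extends to an automorphism. *)
Lemma indiscernible_conjugate (A : set C) m (bs : nat -> 'I_m -> C) (j : nat) :
  A !=set0 -> small K A -> indiscernible A bs ->
  exists s, [/\ automorphism s, forall c, A c -> s c = c & s \o bs 0%N = bs j].
Proof.
move=> [a0 Aa0] Asmall ib.
have conj p (phi : formula L ('I_m + 'I_p)) (c : 'I_p -> C) : (forall q, A (c q)) ->
    sat (valpair (bs 0%N) c) phi <-> sat (valpair (bs j) c) phi.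
  move=> cA.
  pose z (x : 'I_m + 'I_p) : 'I_1 * 'I_m + 'I_p :=
    match x with inl s => inl (ord0, s) | inr q => inr q end.
  have zE i : seqval bs (fun=> i) c \o z = valpair (bs i) c.
    by apply/funext => -[].
  rewrite -!zE -!sat_frename; apply: ib => //.
    by move=> r r'; rewrite !ord1.
  by move=> r r'; rewrite !ord1.
(* Equality formulas make the map well defined where coordinates of [bs 0] coincide or lie in
   [A]. *)
have eq_bs s s' : bs 0%N s = bs 0%N s' -> bs j s = bs j s'.
  by move=> e; apply/(conj 0%N (feq (tvar (inl s)) (tvar (inl s')))
    (fun=> a0)) => // -[].
have eq_A s a : A a -> bs 0%N s = a -> bs j s = a.
  by move=> Aa e; apply/(conj 1%N (feq (tvar (inl s)) (tvar (inr ord0)))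
    (fun=> a)).
have H c : exists d, (A c -> d = c) /\ forall s, bs 0%N s = c -> d = bs j s.
  have [Ac|NAc] := pselect (A c).
    by exists c; split=> // s e; rewrite (eq_A s c).
  have [[s e]|N] := pselect (exists s, bs 0%N s = c).
    by exists (bs j s); split=> // s' e'; apply: eq_bs; rewrite e e'.
  by exists c; split=> // s e; case: N; exists s.
have [h hP] := choice H.
pose A' := A `|` range (bs 0%N).
have A'small : small K A'.
  apply: small_setU => //; apply: small_finite => //.
  exact/finite_image/finite_finset.
have hel : elementary_on A' h.
  move=> q phi a aA'.
  (* Coordinates outside [A] get the dummy [a0]; they are read from [bs] instead. *)
  pose c i := if pselect (A (a i)) then a i else a0.
  have Hz i : exists z : 'I_m + 'I_q, valpair (bs 0%N) c z = a i /\
      valpair (bs j) c z = h (a i).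
    have [Aa|[s _ e]] := aA' i.
      exists (inr i); rewrite /= /c; case: pselect => // Aa'.
      by rewrite (hP (a i)).1.
    by exists (inl s); rewrite /= e; split=> //; rewrite -((hP (a i)).2 s e).
  have [z zP] := choice Hz.
  rewrite (_ : a = valpair (bs 0%N) c \o z); last by apply/funext => i; case: (zP i).
  rewrite [X in _ <-> sat X _](_ : _ = valpair (bs j) c \o z); last first.
    by apply/funext => i /=; case: (zP i) => ->.
  rewrite -!sat_frename; apply: conj => i.
  by rewrite /c; case: pselect.
have [s sa sh] := Chom A'small hel; exists s; split=> //.
  by move=> c Ac; rewrite sh ?(hP c).1//; apply/mem_set; left.
apply/funext => i /=; rewrite sh; last by apply/mem_set; right; exists i.
exact: (hP _).2.
Qed.

Definition conjset n (s : C -> C) (D : set ('I_n -> C)) : set ('I_n -> C) :=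
  [set a | D (s \o a)].

Lemma conjset_defset n m (s : C -> C) (phi : formula L ('I_n + 'I_m)) b :
  automorphism s -> conjset s (defset phi (s \o b)) = defset phi b.
Proof.
move=> sa; rewrite /conjset /defset; apply/funext => a; apply/propext => /=.
rewrite -(sat_automorphism (valpair a b) phi sa).
by rewrite (_ : valpair _ _ = s \o valpair a b)//; apply/funext => -[].
Qed.

Lemma conjset_definable n (s : C -> C) (A : set C) (D : set ('I_n -> C)) :
  automorphism s -> (forall c, A c -> s c = c) -> definable A D ->
  conjset s D = D.
Proof.
move=> sa sA [m [phi [b [bA ->]]]]; rewrite -[RHS](conjset_defset phi b sa).
by congr (conjset s (defset phi _)); apply/funext => j /=; rewrite sA.
Qed.

(* Averaging over the automorphisms that carry [bs 0] to [bs j]. *)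
Lemma average_conjugates (R : realType) n m (A : set C)
    (phi : formula L ('I_n + 'I_m)) (bs : nat -> 'I_m -> C)
    (nu : set ('I_n -> C) -> R) (w : nat) :
  A !=set0 -> small K A -> indiscernible A bs -> fa_probability nu -> (0 < w)%N ->
  exists mu : set ('I_n -> C) -> R, [/\ fa_probability mu, extends A nu mu &
    forall j D, (j < w)%N -> definable A D ->
      nu (D `&` defset phi (bs 0%N)) / w%:R <= mu (D `&` defset phi (bs j))].
Proof.
move=> A0 Asmall ib nup w0.
have [s sP] := choice (fun j => indiscernible_conjugate j A0 Asmall ib).
have wn0 : w%:R != 0 :> R by rewrite pnatr_eq0 -lt0n.
have sum_nu D : definable A D -> \sum_(j < w) nu (conjset (s j) D) = nu D *+ w.
  move=> dD; rewrite (eq_bigr (fun=> nu D)) ?sumr_const ?card_ord// => j _.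
  by have [sa sA _] := sP j; rewrite (conjset_definable sa sA).
have ext : extends A nu (fun D => (\sum_(j < w) nu (conjset (s j) D)) / w%:R).
  by move=> D dD; rewrite sum_nu// -[_ *+ w]mulr_natr mulfK.
exists (fun D => (\sum_(j < w) nu (conjset (s j) D)) / w%:R); split=> //.
- split; last by rewrite ext ?nup.2//; exact: definableT.
  split=> [D|D E DE]; first by rewrite divr_ge0// sumr_ge0// => j _; exact: nup.1.1.
  rewrite -mulrDl -big_split /=; congr (_ / _); apply: eq_bigr => j _.
  by rewrite -nup.1.2//; apply/eqP/negPn/negP => /set0P[a []]; rewrite /conjset /= => h1 h2;
    have : (D `&` E) (s j \o a) by []; rewrite DE.
- move=> j D jw dD; rewrite ler_pM2r ?invr_gt0 ?ltr0n//.
  (* All terms but the [j]-th are dropped; its automorphism fixes [D] and carries [bs 0] to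
     [bs j]. *)
  rewrite (bigD1 (Ordinal jw))//= -[leLHS]addr0 lerD//; last first.
    by rewrite sumr_ge0// => i _; exact: nup.1.1.
  have [sa sA sb] := sP j.
  have -> : conjset (s j) (D `&` defset phi (bs j)) = D `&` defset phi (bs 0%N).
    rewrite -[in RHS](conjset_definable sa sA dD).
    by rewrite -(conjset_defset phi (bs 0%N) sa) sb.
  by [].
Qed.

End Conjugates.

Section SingleFormula.
Variables (L : language) (C : structure L) (K : Type) (R : realType) (n : nat).
Hypotheses (K_unc : card_lt [set: nat] [set: K]) (Csat : saturated K C)
  (Chom : strongly_homogeneous K C) (C_NTP2 : NTP2 C).
Implicit Types (A : set C) (mu nu : set ('I_n -> C) -> R).

(** Quantifying over all extensions of [mu] makes the condition survive enlarging [A] and extending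
    [mu]. *)
Definition null_dividing A mu m (phi : formula L ('I_n + 'I_m)) (k : nat) (eps : R) :=
  forall nu b, fa_probability nu -> extends A mu nu -> kdivides A phi k b ->
    nu (defset phi b) < eps.

Lemma extends_trans A A' mu nu rho :
  A `<=` A' -> extends A mu nu -> extends A' nu rho -> extends A mu rho.
Proof.
by move=> AA' h1 h2 D dD; rewrite h2 ?h1//; exact: definable_mono dD.
Qed.

Lemma null_dividing_mono A A' mu mu' m (phi : formula L ('I_n + 'I_m)) k eps :
  A `<=` A' -> extends A mu mu' -> null_dividing A mu phi k eps ->
  null_dividing A' mu' phi k eps.
Proof.
move=> AA' ext H nu b nup ext' kd; apply: H nup _ (kdivides_mono AA' kd).
exact: extends_trans ext'.
Qed.

(** Otherwise each finite enlargement still admits a dividing instance of measure at least [eps].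
    Iterating the averaging of conjugates gives the data of [consistent_paths] for each width [w],
    and so TP2. *)
Lemma ex_null_dividing A mu m (phi : formula L ('I_n + 'I_m)) k eps :
  A !=set0 -> small K A -> fa_probability mu -> 0 < eps ->
  exists F mu', [/\ finite_set F, fa_probability mu', extends A mu mu' &
                    null_dividing (A `|` F) mu' phi k eps].
Proof.
move=> [a0 Aa0] Asmall mup eps0; apply: contrapT => none.
pose good (p : set C * (set ('I_n -> C) -> R)) :=
  [/\ finite_set p.1, fa_probability p.2 & extends A mu p.2].
apply: (C_NTP2 (phi := phi)); apply: (finite_arrays_TP2 (k := k) K_unc Csat) => w w0.
have step (st : {p | good p}) :
    exists y : {p | good p} * (nat -> 'I_m -> C) * (set ('I_n -> C) -> R),
    let F := (sval st).1 in let F' := (sval y.1.1).1 in let mu' := (sval y.1.1).2 in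
    let E j := defset phi (y.1.2 j) in let la := y.2 in
    [/\ F `<=` F' /\ (forall j i, (j < w)%N -> F' (y.1.2 j i)),
        extends (A `|` F) (sval st).2 mu',
        k_inconsistent k E,
        [/\ fa_measure la, la setT <= 1 & eps <= la setT] &
        forall j D, (j < w)%N -> definable (A `|` F) D ->
          la D / w%:R <= mu' (D `&` E j)].
  case: st => [[F mu1] [/= Ffin mu1p ext1]].
  have [nu [b [nup ext [bs [ib b0 ki]] le_eps]]] : exists nu b,
      [/\ fa_probability nu, extends (A `|` F) mu1 nu, kdivides (A `|` F) phi k b &
          eps <= nu (defset phi b)].
    apply: contrapT => N; apply: none; exists F, mu1; split=> // nu b nup ext kd.
    by rewrite ltNge; apply/negP => le; apply: N; exists nu, b.
  have AF0 : A `|` F !=set0 by exists a0; left.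
  have AFsmall : small K (A `|` F).
    by apply: small_setU => //; exact: small_finite.
  have [mu2 [mu2p ext2 mu2P]] :=
    average_conjugates K_unc Chom phi AF0 AFsmall ib nup w0.
  have sAF : A `<=` A `|` F by move=> x; left.
  (* Only the first [w] members of the witnessing sequence are added, to keep the set finite. *)
  have g : good (F `|` [set bs j i | j in `I_w & i in setT], mu2).
    split=> //=.
      rewrite finite_setU; split=> //; apply: finite_image2; first exact: finite_II.
      exact: finite_finset.
    apply: (extends_trans sAF ext1) => D dD; rewrite ext2//; exact: ext.
  exists (exist _ _ g, bs, fun D => nu (D `&` defset phi b)) => /=; split=> //.
  - by split=> [x|j i jw]; [left|right; exists j => //; exists i].
  - by move=> D dD; rewrite ext2//; exact: ext.
  - split; last by rewrite setTI.
      split=> [D|D E DE]; first exact: nup.1.1.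
      by rewrite setIUl nup.1.2// setIACA DE set0I.
    by case/andP: (fa_probability01 (setT `&` defset phi b) nup).
  - by move=> j D jw dD; rewrite -b0; exact: mu2P.
have [nxt nxtP] := choice step.
have g0 : good (set0, mu) by split.
pose fix st i := if i is i'.+1 then (nxt (st i')).1.1 else exist _ _ g0.
pose bs i := (nxt (st i)).1.2; pose la i := (nxt (st i)).2.
pose Ai i := A `|` (sval (st i)).1.
have gst i : good (sval (st i)) by apply: svalP.
have P i := nxtP (st i).
have AiS i : Ai i `<=` Ai i.+1.
  by move=> x [|Fx]; [left|right; have [[FF' _] _ _ _ _] := P i; exact: FF'].
(* The width [w] is also taken as the number of rows. *)
have [h hP] := @consistent_paths R ('I_n -> C) (fun i => definable (Ai i))
  (fun i => (sval (st i)).2) la (fun i j => defset phi (bs i j)) w eps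
  (fun i => definableT _ (Ai i)) (fun i => @definableI _ _ _ (Ai i))
  (fun i => @definableC _ _ _ (Ai i)) (fun i D => definable_mono (AiS i))
  w0 eps0 (fun i => let: And3 _ p _ := gst i in p)
  (fun i => let: And5 _ p _ _ _ := P i in p)
  (fun i => let: And5 _ _ _ (And3 p _ _) _ := P i in p)
  (fun i => let: And5 _ _ _ (And3 _ p _) _ := P i in p)
  (fun i => let: And5 _ _ _ (And3 _ _ p) _ := P i in p)
  (fun i j jw => let: And5 (conj _ p) _ _ _ _ := P i in
     definable_defset phi (fun s => or_intror (p j s jw)))
  (fun i => let: And5 _ _ _ _ p := P i in p) w.
exists (fun i j => bs (h i) j); split=> [i|eta etaw]; last exact: hP.
by have [] := P (h i).
Qed.

End SingleFormula.

(** * Number of formulas and the Lowenheim-Skolem theorem *)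

Section Cardinality.

(** Variables go to an arbitrary [Z]: numbers when formulas are coded, [V] itself when terms are
    counted. *)
Fixpoint tcode (L : language) V Z (e : V -> Z) (t : term L V) :
    GenTree.tree (Defs.fsym L + Z) :=
  match t with
  | tvar x => GenTree.Leaf (inr (e x))
  | tapp f ts => GenTree.Node 0 (GenTree.Leaf (inl f) ::
                   [seq tcode e (ts i) | i <- enum 'I_(farity f)])
  end.

Lemma tcode_inj L V Z (e : V -> Z) : injective e -> injective (@tcode L V Z e).
Proof.
move=> ei; elim=> [x|f ts IH] [y|g us] //=; first by move=> [/ei ->].
case=> efg; case: _ / efg us => us /eq_in_map H.
by congr tapp; apply/funext => i; apply/IH/H; rewrite mem_enum.
Qed.

(** Under a quantifier the numbering is shifted and [None] gets [0], which keeps it injective. *)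
Fixpoint fcode (L : language) V (e : V -> nat) (phi : formula L V) :
    GenTree.tree (GenTree.tree (Defs.fsym L + nat) + rsym L) :=
  match phi with
  | fbot => GenTree.Node 0 [::]
  | feq s t => GenTree.Node 1
      [:: GenTree.Leaf (inl (tcode e s)); GenTree.Leaf (inl (tcode e t))]
  | fatom r ts => GenTree.Node 2 (GenTree.Leaf (inr r) ::
      [seq GenTree.Leaf (inl (tcode e (ts i))) | i <- enum 'I_(rarity r)])
  | fimp p q => GenTree.Node 3 [:: fcode e p; fcode e q]
  | fall p => GenTree.Node 4 [:: fcode (oapp (succn \o e) 0%N) p]
  end.

Lemma fcode_inj L V (e : V -> nat) : injective e -> injective (@fcode L V e).
Proof.
move=> ei phi; elim: phi e ei => {V}[V|V s t|V r ts|V p IHp q IHq|V p IH] e ei.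
- by case.
- case=> //= s' t' [/(tcode_inj ei) -> /(tcode_inj ei) ->]//.
- case=> //= r' ts' [er]; case: _ / er ts' => ts' /eq_in_map H.
  congr fatom; apply/funext => i; have iI : i \in enum 'I_(rarity r) by rewrite mem_enum.
  by have [/(tcode_inj ei)] := H i iI.
- by case=> //= p' q' [/(IHp _ ei) -> /(IHq _ ei) ->].
- case=> //= p' [/IH ->]// [x|] [y|] //= [/ei ->]//.
Qed.

Lemma embeds_term L V Y : embeds nat Y -> embeds (Defs.fsym L) Y -> embeds V Y ->
  embeds (term L V) Y.
Proof.
move=> eN eF eV; apply: (@embeds_trans _ (GenTree.tree (Defs.fsym L + V))).
  by exists (tcode id); exact: tcode_inj.
by apply: embeds_tree => //; exact: embeds_add.
Qed.

Lemma embeds_formula L (V : countType) Y : embeds nat Y ->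
  embeds (Defs.fsym L) Y -> embeds (rsym L) Y -> embeds (formula L V) Y.
Proof.
move=> eN eF eR; eapply embeds_trans.
  by exists (fcode (@pickle V)); apply/fcode_inj/(pcan_inj pickleK).
apply: embeds_tree => //; apply: embeds_add => //.
by apply: embeds_tree => //; exact: embeds_add.
Qed.

End Cardinality.

Section LowenheimSkolem.
Variables (L : language) (C : structure L).

Lemma tarski_vaught (N : set C) :
  (forall m (phi : formula L (option 'I_m)) (a : 'I_m -> C),
     (forall i, N (a i)) -> (exists c, sat (oapp a c) phi) ->
     exists2 c, N c & sat (oapp a c) phi) ->
  elementary_substructure N.
Proof.
move=> TV; have [c0] := dom_inhabited C.
have N0 : N !=set0.
  have [[]//||c Nc _] := TV 0%N (ftrue L _) (fun=> c0); first by exists c0 => /=.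
  by exists c.
have Nf : Defs.fclosed N.
  move=> f a aN.
  have [//||c Nc /= <-] := TV (farity f)
    (feq (tvar None) (tapp f (fun i => tvar (Some i)))) a; last by [].
  by exists (fint C f a).
exists N0, Nf; set S := substructure N0 Nf.
have evalE V (a : V -> S) (t : term L V) :
    sval (eval a t) = eval (fun x => sval (a x) : C) t.
  by elim: t => //= f ts IH; congr (fint C f _); exact/funext.
(* The induction leaves ['I_m] for other variable types; a retraction of some ['I_m] onto [V] brings
   the quantifier case back to the form of [TV]. *)
suff satE V (phi : formula L V) m (e : V -> 'I_m) (g : 'I_m -> V) : cancel e g ->
    forall a : V -> S, sat a phi <-> sat (fun x => sval (a x) : C) phi.
  by move=> m phi a; exact: (satE _ phi m id id).
elim: phi m e g => {V}[V|V s t|V r ts|V p IHp q IHq|V p IH] m e g eg a //=.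
- by rewrite -!evalE; split=> [->//|]; exact: sval_inj.
- by under [in X in _ <-> X]eq_fun do rewrite -evalE.
- by rewrite (IHp _ _ _ eg) (IHq _ _ _ eg).
have {}IH : forall a : option V -> S, sat a p <-> sat (fun x => sval (a x) : C) p.
  apply: (IH m.+1 (oapp (lift ord0 \o e) ord0) (fun i => omap g (unlift ord0 i))).
  by move=> [x|] /=; rewrite ?liftK ?unlift_none//= eg.
have E (c : S) : (fun x => sval (oapp a c x)) = oapp (fun x => sval (a x)) (sval c).
  by apply/funext => -[].
split=> [H c|H c]; last by apply/IH; rewrite E.
apply: contrapT => Nc.
have [i||d Nd] := TV m (frename (omap e) (fnot p)) (fun i => sval (a (g i))).
- exact: svalP.
- exists c; apply/sat_frename; move: Nc; rewrite [_ \o _](_ : _ = oapp (sval \o a) c)//.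
  by apply/funext => -[x|] //=; rewrite eg.
move=> /sat_frename; rewrite [_ \o _](_ : _ = oapp (sval \o a) d); last first.
  by apply/funext => -[x|] //=; rewrite eg.
by apply; have /IH := H (exist _ d Nd); rewrite E.
Qed.

(** One function symbol per formula with a distinguished variable, so that terms over [A] name the
    points of the Skolem hull of [A] and counting terms bounds its size. *)
Definition skolem_language : language :=
  {| Defs.fsym := {m & formula L (option 'I_m)}; farity := @tag _ _;
     rsym := void; rarity := fun=> 0%N |}.

Lemma lowenheim_skolem (A : set C) Y : embeds nat Y -> embeds (Defs.fsym L) Y ->
  embeds (rsym L) Y -> embeds {x | A x} Y ->
  exists N, [/\ A `<=` N, elementary_substructure N & embeds {x | N x} Y].
Proof.
move=> eN eF eR eA; have [c0] := dom_inhabited C.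
have Hsk (u : {u : {m & formula L (option 'I_m)} & 'I_(tag u) -> C}) :
    exists d : C, (exists c, sat (oapp (tagged u) c) (tagged (tag u))) ->
      sat (oapp (tagged u) d) (tagged (tag u)).
  by have [[c cP]|N] := pselect (exists c, sat (oapp (tagged u) c) (tagged (tag u)));
    [exists c|exists c0].
have [sk skP] := choice Hsk.
pose S : structure skolem_language := @Structure skolem_language C
  (dom_inhabited C) (fun f a => sk (Tagged (fun u => 'I_(tag u) -> C) (i := f) a))
  (fun r => match r with end).
pose ev (t : term skolem_language {x | A x}) : C :=
  eval (C := S) (fun u => sval u) t.
exists (range ev); split.
- by move=> x Ax; exists (tvar (exist _ x Ax)).
- apply: tarski_vaught => m phi a aN ex.
  have H i : exists t, ev t = a i by have [t _ e] := aN i; exists t.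
  have [ts tsE] := choice H.
  exists (ev (tapp (L := skolem_language) (existT _ m phi) ts)); first by eexists.
  rewrite /ev /= -/ev (_ : (fun i => _) = a); last exact/funext.
  exact: (skP (Tagged (fun u => 'I_(tag u) -> C) (i := existT _ m phi) a)).
- apply: (@embeds_trans _ (term skolem_language {x | A x})).
    have [f fP] := choice (fun u : {x | range ev x} =>
      let: exist x (ex_intro2 t _ e) := u return exists t, ev t = sval u in
      ex_intro _ t e).
    by exists f => u v e; apply: sval_inj; rewrite /= -!fP e.
  apply: embeds_term => //; apply: embeds_sigT => // m.
  exact: embeds_formula.
Qed.

End LowenheimSkolem.

(** * Smooth extensions *)

(** A point of [g t] is coded by [t] and its number in the countable set [g t]; such pairs fit into
    [Y] by [embeds_square]. *)
Lemma embeds_union_finite T (M : set T) (Tr Y : Type) (S : set Tr)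
    (g : Tr -> set T) :
  embeds nat Y -> embeds {x | M x} Y -> embeds Tr Y ->
  (forall t, finite_set (g t)) ->
  embeds {x | (M `|` \bigcup_(t in S) g t) x} Y.
Proof.
move=> eN eM eT gfin.
have [F FP] := choice (fun t => elimT (countable_injP (g t))
  (finite_set_countable (gfin t))).
have H (u : {x | (M `|` \bigcup_(t in S) g t) x}) :
    exists z : {x | M x} + Tr * nat, match z with
      | inl a => sval a = sval u
      | inr (t, i) => g t (sval u) /\ F t (sval u) = i end.
  case: u => x /= [Mx|[t St gx]]; first by exists (inl (exist _ x Mx)).
  by exists (inr (t, F t x)).
have [f fP] := choice H.
apply: (@embeds_trans _ ({x | M x} + Tr * nat)).
  exists f => u v e; apply: sval_inj; have := fP u; have := fP v; rewrite e.
  case: (f v) => [a <- //|[t i] [gv Fv] [gu Fu]] /=.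
  by apply: (FP t); rewrite ?Fu ?Fv//; apply/mem_set.
apply: embeds_add => //; apply: embeds_trans (embeds_square eN).
have [h hi] := eT; have [e ei] := eN.
by exists (fun p => (h p.1, e p.2)) => -[t i] [t' i'] [/hi -> /ei ->].
Qed.

Section AllFormulas.
Variables (L : language) (C : structure L) (K Y : Type) (R : realType) (n : nat).
Hypotheses (K_unc : card_lt [set: nat] [set: K]) (Csat : saturated K C)
  (Chom : strongly_homogeneous K C) (C_NTP2 : NTP2 C).
Variables (M : set C) (mu0 : set ('I_n -> C) -> R).
Hypotheses (M0 : M !=set0) (mu0p : fa_probability mu0).

Let Tr : Type := {m & formula L ('I_n + 'I_m)} * nat * nat.
Hypotheses (YK : ~ embeds K Y) (YN : embeds nat Y) (YM : embeds {x | M x} Y)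
  (YTr : embeds Tr Y).

(* A triple [(phi, k, q)] is treated once no extension gives measure at least
   [1 / (q + 1)] to a [k]-dividing instance of [phi]; treating it costs a
   finite set of new parameters. *)
Let treated (A : set C) (mu : set ('I_n -> C) -> R) (t : Tr) : Prop :=
  null_dividing A mu (tagged t.1.1) t.1.2 (t.2.+1%:R^-1 : R).

Let params (S : set Tr) (g : Tr -> set C) : set C := M `|` \bigcup_(t in S) g t.

(** Parameters are kept as a family over triples, so that their union embeds in [Y] at every stage,
    including upper bounds of long chains. *)
Record partial_treatment := PartialTreatment {
  pt_set : set Tr;
  pt_params : Tr -> set C;
  pt_mu : set ('I_n -> C) -> R;
  pt_finite : forall t, finite_set (pt_params t);
  pt_prob : fa_probability pt_mu;
  pt_extends : extends M mu0 pt_mu;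
  pt_treated : forall t, pt_set t -> treated (params pt_set pt_params) pt_mu t }.

Let dom_pt x := params (pt_set x) (pt_params x).

Let le_pt (x y : partial_treatment) : Prop :=
  [/\ pt_set x `<=` pt_set y,
      forall t, pt_set x t -> pt_params x t = pt_params y t &
      extends (dom_pt x) (pt_mu x) (pt_mu y)].

Let le_pt_dom x y : le_pt x y -> dom_pt x `<=` dom_pt y.
Proof.
move=> [xy gxy _] c [Mc|[t xt gc]]; first by left.
by right; exists t; [exact: xy|rewrite -gxy].
Qed.

Let le_pt_refl x : le_pt x x. Proof. by split. Qed.

Let le_pt_trans x y z : le_pt x y -> le_pt y z -> le_pt x z.
Proof.
move=> xy yz; have dxy := le_pt_dom xy; have [xy1 xy2 xy3] := xy.
have [yz1 yz2 yz3] := yz; split.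
- exact: subset_trans yz1.
- by move=> t xt; rewrite xy2// yz2//; exact: xy1.
- exact: extends_trans xy3 yz3.
Qed.

Let small_dom x : small K (dom_pt x).
Proof.
move=> /card_leTE KD; apply: YK; apply: embeds_trans KD _.
exact: embeds_union_finite (@pt_finite x).
Qed.

Let pt_start : partial_treatment.
Proof. by refine (@PartialTreatment set0 (fun=> set0) mu0 _ mu0p _ _). Defined.

(** Parameters are glued by union, but the measures of a chain agree only on definable sets. Their
    ultralimit along final segments agrees with each of them on the sets definable over its
    parameters. *)
Lemma le_pt_chain (F : set partial_treatment) : total_on F le_pt ->
  exists y, forall x, F x -> le_pt x y.
Proof.
move=> tF; have [[x0 Fx0]|F0] := pselect (F !=set0); last first.
  by exists pt_start => x Fx; case: F0; exists x.
pose cone x := [set y | le_pt x y].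
have PF : ProperFilter (filter_from F cone).
  apply: filter_from_proper; last by move=> x _; exists x; exact: le_pt_refl.
  apply: filter_from_filter; first by exists x0.
  move=> x y Fx Fy; have [xy|yx] := tF _ _ Fx Fy.
    by exists y => // z yz; split=> //; exact: le_pt_trans yz.
  by exists x => // z xz; split=> //; exact: le_pt_trans xz.
have [U [UU FU]] := ultraFilterLemma PF.
pose mu D := ulim U (fun x => pt_mu x D).
have mup : fa_probability mu by apply: fa_probability_ulim => x; exact: pt_prob.
have ext x : F x -> extends (dom_pt x) (pt_mu x) mu.
  move=> Fx D dD; apply: ulim_near => [y|].
    by apply: fa_probability01; exact: pt_prob.
  by apply: FU; exists x => // y [_ _]; apply.
have Hg t : exists G, finite_set G /\
    forall x, F x -> pt_set x t -> pt_params x t = G.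
  have [[x Fx xt]|N] := pselect (exists2 x, F x & pt_set x t); last first.
    by exists set0; split=> // x Fx xt; case: N; exists x.
  exists (pt_params x t); split=> [|y Fy yt]; first exact: pt_finite.
  by have [[_ H _]|[_ H _]] := tF _ _ Fx Fy; [rewrite H|rewrite H].
have [g gP] := choice Hg.
pose S := \bigcup_(x in F) pt_set x.
have domS x : F x -> dom_pt x `<=` params S g.
  move=> Fx c [Mc|[t xt gc]]; first by left.
  by right; exists t; [exists x|rewrite -((gP t).2 x)].
have gfin t : finite_set (g t) by case: (gP t).
have extM : extends M mu0 mu.
  apply: extends_trans (pt_extends x0) (ext _ Fx0) => c Mc; by left.
have trS t : S t -> treated (params S g) mu t.
  move=> [x Fx xt]; apply: null_dividing_mono (domS x Fx) (ext x Fx) _.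
  exact: pt_treated.
exists (PartialTreatment gfin mup extM trS) => x Fx; split=> /=.
- by move=> t xt; exists x.
- by move=> t xt; exact: (gP t).2.
- exact: ext.
Qed.

Lemma treat_one (x : partial_treatment) (t : Tr) : ~ pt_set x t ->
  exists2 y, le_pt x y & pt_set y t.
Proof.
move=> xt; have dom0 : dom_pt x !=set0 by have [c Mc] := M0; exists c; left.
have eps0 : 0 < (t.2.+1%:R^-1 : R) by rewrite invr_gt0 ltr0n.
have [F [mu [Ffin mup ext nd]]] := ex_null_dividing K_unc Csat Chom C_NTP2
  (tagged t.1.1) t.1.2 dom0 (small_dom (x:=x)) (pt_prob x) eps0.
pose g t' := if `[< t' = t >] then F else pt_params x t'.
pose S := pt_set x `|` [set t].
have gx t' : pt_set x t' -> g t' = pt_params x t'.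
  by move=> xt'; rewrite /g; case: asboolP => // e; case: xt; rewrite -e.
have gt : g t = F by rewrite /g; case: asboolP.
have domS : dom_pt x `<=` params S g.
  move=> c [Mc|[t' xt' gc]]; first by left.
  by right; exists t'; [left|rewrite gx].
have gfin t' : finite_set (g t').
  by rewrite /g; case: ifP => // _; exact: pt_finite.
have extM : extends M mu0 mu.
  apply: extends_trans (pt_extends x) ext => c Mc; by left.
have trS t' : S t' -> treated (params S g) mu t'.
  move=> [xt'|->].
    by apply: null_dividing_mono domS ext _; exact: pt_treated.
  apply: null_dividing_mono nd => // c [/domS//|Fc].
  by right; exists t; [right|rewrite gt].
exists (PartialTreatment gfin mup extM trS); last by right.
by split=> //= [t' xt'|t' xt']; [left|rewrite gx].
Qed.

Lemma treat_all : exists A mu, [/\ M `<=` A, embeds {x | A x} Y,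
  fa_probability mu, extends M mu0 mu &
  forall m (phi : formula L ('I_n + 'I_m)) k q,
    null_dividing A mu phi k (q.+1%:R^-1 : R)].
Proof.
(* [le_pt] is only a preorder, as measures may differ outside definable sets. *)
have [|||x xmax] := @ZL_preorder _ pt_start (fun x y => `[< le_pt x y >]).
- by move=> x; apply/asboolP; exact: le_pt_refl.
- by move=> x y z /asboolP xy /asboolP yz; apply/asboolP; exact: le_pt_trans yz.
- move=> F tF; have [s t Fs Ft|y yP] := @le_pt_chain F.
    by have [/asboolP|/asboolP] := tF _ _ Fs Ft; [left|right].
  by exists y => z Fz; apply/asboolP; exact: yP.
have all t : pt_set x t.
  apply: contrapT => xt; have [y xy yt] := treat_one xt; apply: xt.
  by have /asboolP[yx _ _] := xmax y (asboolT xy); exact: yx.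
exists (dom_pt x), (pt_mu x); split.
- by move=> c Mc; left.
- exact: embeds_union_finite (@pt_finite x).
- exact: pt_prob.
- exact: pt_extends.
- by move=> m phi k q; exact: (pt_treated (all (existT _ m phi, k, q))).
Qed.

End AllFormulas.

(** * Choice of the model and smoothness *)

Lemma embeds_of_setT (K X : Type) : embeds K X -> ([set: K] #<= [set: X])%card.
Proof.
by move=> [f fi]; apply/card_leTE; exists (fun k => exist _ (f k) I) => k k' [/fi].
Qed.

Lemma keisler_extension (R : realType) (L : language) (C : structure L) (n : nat)
    (A : set C) (mu : set ('I_n -> C) -> R) : keisler_measure A mu ->
  exists2 nu, fa_probability nu & extends A mu nu.
Proof.
move=> [mu0 mu1 muD]; apply: (fa_extension (B := definable A)) => //.
- exact: definableT.
- exact: definableI.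
- exact: definableC.
Qed.

Theorem theorem3p8 (L : language) (T : theory L) (K : Type) (C : structure L)
    (T_complete : complete_theory T) (C_monster : monster_model K T C)
    (T_NTP2 : NTP2 C)
    (M : set C) (M_elem : elementary_substructure M) (M_small : small K M)
    (R : realType) (n : nat) (mu : set ('I_n -> C) -> R)
    (mu_keisler : keisler_measure M mu) :
  exists (N : set C) (mu' : set ('I_n -> C) -> R),
    [/\ M `<=` N, elementary_substructure N & small K N] /\
    [/\ keisler_measure N mu', extends M mu mu' & NTP2_smooth N mu'].
Proof.
have [K_unc [F_small R_small] _ Csat Chom] := C_monster.
have [M0 _] := M_elem.
have [mu0 mu0p ext0] := keisler_extension mu_keisler.
(* [Y] stands for |M| + |L| + aleph_0; [K] embeds in none of the summands, hence not in [Y]. *)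
pose Y : Type := {x | M x} + (Defs.fsym L + (rsym L + nat)).
have YK : ~ embeds K Y.
  have sum := embeds_sum (embeds_nat_uncountable K_unc).
  move=> /sum[/card_leTE//|/sum[/embeds_of_setT//|/sum[/embeds_of_setT//|]]].
  by move/embeds_of_setT.
have YN : embeds nat Y by exists (inr \o (inr \o inr)) => x y [].
have YF : embeds (Defs.fsym L) Y by exists (inr \o inl) => x y [].
have YR : embeds (rsym L) Y by exists (inr \o (inr \o inl)) => x y [].
have YM : embeds {x | M x} Y by exists inl => x y [].
have YTr : embeds ({m & formula L ('I_n + 'I_m)} * nat * nat) Y.
  have [f fi] : embeds {m & formula L ('I_n + 'I_m)} Y.
    by apply: embeds_sigT => // m; exact: embeds_formula.
  have [s si] := embeds_square YN; have [e ei] := YN.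
  exists (fun t => s (s (f t.1.1, e t.1.2), e t.2)) => -[[u k] q] [[u' k'] q'].
  by move=> /si[/si[/fi -> /ei ->] /ei ->].
have [A [mu' [MA YA mu'p ext' null]]] :=
  treat_all K_unc Csat Chom T_NTP2 M0 mu0p YK YN YM YTr.
have [N [AN Nel YNN]] := lowenheim_skolem YN YF YR YA.
exists N, mu'; split; split=> //.
- exact: subset_trans AN.
- by move=> /card_leTE KN; apply: YK; exact: embeds_trans YNN.
- by split=> [D _||D E _ _]; [exact: mu'p.1.1|exact: mu'p.2|exact: mu'p.1.2].
- by move=> D dD; rewrite ext' ?ext0.
move=> B nu NB nuk extnu m phi b bB div.
(* Extending [nu] to all subsets brings it within the scope of [null]. *)
have [nu' nu'p ext''] := keisler_extension nuk.
have [k kd] := divides_kdivides div.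
have AB : A `<=` B by exact: subset_trans NB.
have extA : extends A mu' nu'.
  move=> D dD; rewrite ext''; last exact: definable_mono dD.
  by rewrite extnu//; exact: definable_mono dD.
rewrite -ext''; last exact: definable_defset.
(* [k]-dividing over [N] implies [k]-dividing over the smaller set [A] of treated parameters. *)
have lt q := null m phi k q nu' b nu'p extA (kdivides_mono AN kd).
apply/eqP; rewrite eq_le nu'p.1.1 andbT leNgt; apply/negP => gt0.
(* A positive value would be at least [1 / (q + 1)] for some [q]. *)
have [q qP] : exists q : nat, (nu' (defset phi b))^-1 < q%:R.
  by exists (Num.bound (nu' (defset phi b))^-1); apply: archi_boundP; rewrite invr_ge0 ltW.
have := lt q; rewrite ltNge; apply/negP/negPn.
rewrite -[leRHS]invrK lef_pV2 ?posrE ?invr_gt0 ?ltr0n//.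
by apply: ltW; apply: lt_trans qP _; rewrite ltr_nat.
Qed.
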